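(* There exists a family of simple closed curves of size $O(n^{4/3}\log^{2/3}n)$ on the sphere $S_n$ with $n$ (unlabelled) punctures that realizes all types of pants.
   Context: A pair of pants is a surface homeomorphic to a sphere with $3$ punctures. The punctures of $S_n$ are unlabelled (indistinguishable). The topological type of a pair of pants $P\subseteq S_n$ (bounded by three pairwise disjoint simple closed curves) is the triple $(k_1,k_2,k_3)$ of nonnegative integers such that the three components of $S_n\setminus P$ have $k_1$, $k_2$ and $k_3$ punctures of $S_n$ (the boundary $\partial P$ is not counted as a puncture); one orders it so that $k_1\le k_2\le k_3$, and $k_1+k_2+k_3=n$. The bounding curves are allowed to be contractible or to encircle a single puncture (corresponding to $k_i=0$ or $k_i=1$). A family $\Gamma$ of simple closed curves on $S_n$ realizes all types of pants if for every topological type $(k_1,k_2,k_3)$ there exist three disjoint curves in $\Gamma$ bounding a pair of pants of that type. The $O(\cdot)$ is as $n\to\infty$. *)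

(* Defs.v *)
From HB Require Import structures.
From mathcomp Require Import all_boot all_order all_algebra.
From mathcomp Require Import all_classical all_reals all_analysis.
Set Implicit Arguments.
Unset Strict Implicit.
Unset Printing Implicit Defensive.
Import Order.TTheory GRing.Theory Num.Theory.
Import numFieldNormedType.Exports.
Local Open Scope classical_set_scope.
Local Open Scope ring_scope.
Local Open Scope card_scope.

Definition unit_sphere (R : realType) (d : nat) : set 'rV[R]_d :=
  [set v | \sum_(i < d) v ord0 i ^+ 2 = 1].

(* [set_type A] carries the subset topology. *)
Notation circle R := (set_type (@unit_sphere R 2)).
Notation sphere R := (set_type (@unit_sphere R 3)).

Definition homeomorphic (X Y : topologicalType) : Prop :=
  exists (f : X -> Y) (g : Y -> X),
    [/\ continuous f, continuous g, cancel f g & cancel g f].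

Definition components (X : topologicalType) (A : set X) : set (set X) :=
  [set connected_component A x | x in A].

Section PuncturedSphere.
Variable R : realType.
Implicit Types (Q P A D c : set (sphere R)).

(* The surface S_n is the complement of a set Q of n points of the sphere. *)
Definition punctured_sphere Q : set (sphere R) := ~` Q.

(* Curves are unparametrized: a curve is the image of its parametrization. *)
Definition simple_closed_curve Q c : Prop :=
  c `<=` punctured_sphere Q /\
  exists gamma : circle R -> sphere R,
    [/\ continuous gamma, injective gamma & range gamma = c].

(* A pair of pants is an open surface: it does not contain its boundary. *)
Definition pair_of_pants Q P : Prop :=
  P `<=` punctured_sphere Q /\
  exists E : set (sphere R),
    E #= `I_3 /\ homeomorphic (set_type P) (set_type (punctured_sphere E)).

(* Topological boundary of A relative to the subspace S_n. *)
Definition boundary Q A : set (sphere R) :=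
  punctured_sphere Q `&` (closure A `&` closure (punctured_sphere Q `\` A)).

(* A missing point q of S_n is a puncture of D when D contains a punctured
   neighbourhood of q. *)
Definition punctures Q D : set (sphere R) :=
  [set q | Q q /\ \forall x \near q^', D x].

Definition has_topological_type Q P (k1 k2 k3 : nat) : Prop :=
  exists D1 D2 D3 : set (sphere R),
    [/\ components (punctured_sphere Q `\` P) = [set D1; D2; D3],
        [/\ D1 <> D2, D1 <> D3 & D2 <> D3]
      & [/\ punctures Q D1 #= `I_k1, punctures Q D2 #= `I_k2
          & punctures Q D3 #= `I_k3]].

Definition bound_pants_of_type Q (c1 c2 c3 : set (sphere R))
    (k1 k2 k3 : nat) : Prop :=
  exists P : set (sphere R),
    [/\ pair_of_pants Q P, boundary Q P = c1 `|` c2 `|` c3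
      & has_topological_type Q P k1 k2 k3].

Definition realizes_all_types (n : nat) Q (Gamma : set (set (sphere R))) :
    Prop :=
  forall k1 k2 k3 : nat,
    (k1 <= k2 <= k3)%N -> (k1 + k2 + k3 = n)%N ->
    exists c1 c2 c3 : set (sphere R),
      [/\ [/\ Gamma c1, Gamma c2 & Gamma c3],
          [/\ [disjoint c1 & c2], [disjoint c1 & c3] & [disjoint c2 & c3]]
        & bound_pants_of_type Q c1 c2 c3 k1 k2 k3].

End PuncturedSphere.

(* Main.v *)
Require Import Defs.
From HB Require Import structures.
From mathcomp Require Import all_boot all_order all_algebra.
From mathcomp Require Import all_classical all_reals all_analysis.
From mathcomp Require Import zify ring lra.
Import Order.TTheory GRing.Theory Num.Theory.
Import numFieldNormedType.Exports.
Local Open Scope classical_set_scope.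
Local Open Scope ring_scope.
Local Open Scope card_scope.
Set Implicit Arguments.
Unset Strict Implicit.
Unset Printing Implicit Defensive.

(** Put the punctures in convex position, in the order [0, ..., n - 1] along an
    arc, and let a curve with cuts [s < t] separate the interval [[s, t)] from
    the rest. Cuts [u <= v <= w <= n] then bound pants of type
    [(v - u, w - v, n - w + u)]. In base [c ~ (n/3)^(1/3)], take as admissible
    cuts [u], [v], [w] the numbers whose digit 0, digit 1, digit 2,
    respectively, vanishes: for all gaps [k1 <= k2 <= k3] some
    [u < c^3 <= k3 + 1] makes [u], [u + k1] and [u + k1 + k2] admissible, the
    digits of [u] being chosen one after the other. There are [O(c^2)] cuts of
    each kind, hence [O(c^4) = O(n^(4/3))] curves, and no logarithm is needed.

    Geometrically, homeomorphisms of R^3 which are positively homogeneous of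
    degree 1 act on the sphere by radial projection, and a disk is the preimage
    of the hemisphere [x >= 0] under such a map. The complement of three
    disjoint disks is a thrice punctured sphere because a disk can be collapsed
    to a point by a map which is the identity away from a neighbourhood. In
    generic homogeneous coordinates the punctures lie in [x > 0] with distinct
    slopes [y / x], and the curve with cuts [s], [t] is
    [r x = |y - m x| + eps |z|], where [m] and [r] are the midpoint and the
    half-length of a slope interval and [eps] is small. *)

(** * Radial projection onto the sphere *)

Lemma continuous_at_into_set_type (T X : topologicalType) (A : set X)
    (f : T -> set_type A) (x : T) :
  {for x, continuous (fun t => val (f t))} -> {for x, continuous f}.
Proof.
move=> cf U [?/= [[W oW <-]]] /= Wfx /filterS; apply; apply: cf.
exact: open_nbhs_nbhs.
Qed.

Lemma continuous_val (X : topologicalType) (A : set X) :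
  continuous (fun t : set_type A => val t).
Proof. exact: initial_continuous. Qed.

Lemma continuous_at_congr (T U : topologicalType) (f g : T -> U) (x : T) :
  (\forall y \near x, f y = g y) -> {for x, continuous f} ->
  {for x, continuous g}.
Proof.
move=> fg cf; rewrite /prop_for /continuous_at -(nbhs_singleton fg).
by apply: cvg_trans cf; apply: near_eq_cvg.
Qed.

Section RealContinuity.
Variables (R : realType) (T : topologicalType) (f g : T -> R) (x : T).
Hypotheses (cf : continuous_at x f) (cg : continuous_at x g).

Lemma continuous_at_cst (a : R) : continuous_at x (fun=> a).
Proof. exact: cvg_cst. Qed.

Lemma continuous_atN : continuous_at x (fun t => - f t).
Proof. exact: cvgN. Qed.

Lemma continuous_atD : continuous_at x (fun t => f t + g t).
Proof. exact: cvgD. Qed.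

Lemma continuous_atM : continuous_at x (fun t => f t * g t).
Proof. exact: cvgM. Qed.

Lemma continuous_at_sqr : continuous_at x (fun t => f t ^+ 2).
Proof. exact: (cvgM cf cf). Qed.

Lemma continuous_at_norm : continuous_at x (fun t => `|f t|).
Proof. exact: cvg_norm. Qed.

Lemma continuous_at_max : continuous_at x (fun t => Num.max (f t) (g t)).
Proof. exact: (@continuous_max R T f g). Qed.

Lemma continuous_at_min : continuous_at x (fun t => Num.min (f t) (g t)).
Proof. exact: (@continuous_min R T f g). Qed.

Lemma continuous_at_sqrt : continuous_at x (fun t => Num.sqrt (f t)).
Proof. exact: (continuous_cvg _ (@sqrt_continuous _ _) cf). Qed.

End RealContinuity.

(** Follows the syntax of the expression; continuity of the atoms, usually the three coordinates,
    must be among the hypotheses. *)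
Ltac solve_continuous := rewrite ?/prop_for; repeat lazymatch goal with
  | |- continuous_at _ (fun _ => ?a) => exact: continuous_at_cst
  | |- continuous_at _ (fun t => @?f t + @?g t) =>
         apply: (@continuous_atD _ _ f g)
  | |- continuous_at _ (fun t => - @?f t) => apply: (@continuous_atN _ _ f)
  | |- continuous_at _ (fun t => @?f t ^+ 2) =>
         apply: (@continuous_at_sqr _ _ f)
  | |- continuous_at _ (fun t => @?f t * @?g t) =>
         apply: (@continuous_atM _ _ f g)
  | |- continuous_at _ (fun t => `|@?f t|) => apply: (@continuous_at_norm _ _ f)
  | |- continuous_at _ (fun t => Num.max (@?f t) (@?g t)) =>
         apply: (@continuous_at_max _ _ f g)
  | |- continuous_at _ (fun t => Num.min (@?f t) (@?g t)) =>
         apply: (@continuous_at_min _ _ f g)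
  | |- continuous_at _ (fun t => Num.sqrt (@?f t)) =>
         apply: (@continuous_at_sqrt _ _ f)
  | |- _ => assumption
  end.

Section Space.
Variable R : realType.
Local Notation vec := 'rV[R]_3.

Definition row3 (a b c : R) : vec := \row_(i < 3) nth 0 [:: a; b; c] i.
Definition o1 : 'I_3 := @Ordinal 3 1 isT.
Definition o2 : 'I_3 := @Ordinal 3 2 isT.
Definition cx (v : vec) : R := v ord0 ord0.
Definition cy (v : vec) : R := v ord0 o1.
Definition cz (v : vec) : R := v ord0 o2.

Lemma cx_row3 a b c : cx (row3 a b c) = a. Proof. by rewrite /cx mxE. Qed.
Lemma cy_row3 a b c : cy (row3 a b c) = b. Proof. by rewrite /cy mxE. Qed.
Lemma cz_row3 a b c : cz (row3 a b c) = c. Proof. by rewrite /cz mxE. Qed.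
Lemma cxZ a v : cx (a *: v) = a * cx v. Proof. by rewrite /cx mxE. Qed.
Lemma cyZ a v : cy (a *: v) = a * cy v. Proof. by rewrite /cy mxE. Qed.
Lemma czZ a v : cz (a *: v) = a * cz v. Proof. by rewrite /cz mxE. Qed.
Lemma cxD u v : cx (u + v) = cx u + cx v. Proof. by rewrite /cx mxE. Qed.
Lemma cyD u v : cy (u + v) = cy u + cy v. Proof. by rewrite /cy mxE. Qed.
Lemma czD u v : cz (u + v) = cz u + cz v. Proof. by rewrite /cz mxE. Qed.
Lemma cxN v : cx (- v) = - cx v. Proof. by rewrite /cx mxE. Qed.
Lemma cyN v : cy (- v) = - cy v. Proof. by rewrite /cy mxE. Qed.
Lemma czN v : cz (- v) = - cz v. Proof. by rewrite /cz mxE. Qed.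
Lemma cx0 : cx 0 = 0. Proof. by rewrite /cx mxE. Qed.
Lemma cy0 : cy 0 = 0. Proof. by rewrite /cy mxE. Qed.
Lemma cz0 : cz 0 = 0. Proof. by rewrite /cz mxE. Qed.
Definition cE := (cx_row3, cy_row3, cz_row3, (cxZ, cyZ, czZ), (cxD, cyD, czD),
  (cxN, cyN, czN),  (cx0, cy0, cz0)).

Lemma vec_eq u v : cx u = cx v -> cy u = cy v -> cz u = cz v -> u = v.
Proof.
move=> e0 e1 e2; apply/rowP => -[[|[|[|//]]] im].
- by rewrite (_ : Ordinal im = ord0); [exact: e0 | exact: val_inj].
- by rewrite (_ : Ordinal im = o1); [exact: e1 | exact: val_inj].
- by rewrite (_ : Ordinal im = o2); [exact: e2 | exact: val_inj].
Qed.

Lemma continuous_cx : continuous cx. Proof. exact: coord_continuous. Qed.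
Lemma continuous_cy : continuous cy. Proof. exact: coord_continuous. Qed.
Lemma continuous_cz : continuous cz. Proof. exact: coord_continuous. Qed.

Lemma continuous_row3 (T : topologicalType) (f g h : T -> R) (x : T) :
  continuous_at x f -> continuous_at x g -> continuous_at x h ->
  continuous_at x (fun t => row3 (f t) (g t) (h t)).
Proof.
move=> cf cg ch A [P Pn PA]; rewrite nbhs_simpl /=.
have Pf : nbhs (f x) (P ord0 ord0) by have := Pn ord0 ord0; rewrite mxE.
have Pg : nbhs (g x) (P ord0 o1) by have := Pn ord0 o1; rewrite mxE.
have Ph : nbhs (h x) (P ord0 o2) by have := Pn ord0 o2; rewrite mxE.
near=> t; apply: PA => i j; rewrite mxE ord1.
case: j => -[|[|[|//]]] im /=.
- rewrite (_ : Ordinal im = ord0); last exact: val_inj.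
  by near: t; exact: cf.
- rewrite (_ : Ordinal im = o1); last exact: val_inj.
  by near: t; exact: cg.
- rewrite (_ : Ordinal im = o2); last exact: val_inj.
  by near: t; exact: ch.
Unshelve. all: by end_near. Qed.

Definition nsq (v : vec) : R := cx v ^+ 2 + cy v ^+ 2 + cz v ^+ 2.

Lemma nsqE (v : vec) : \sum_(i < 3) v ord0 i ^+ 2 = nsq v.
Proof.
rewrite !big_ord_recl big_ord0 addr0 addrA /nsq /cx /cy /cz.
rewrite (_ : lift ord0 ord0 = o1); last exact: val_inj.
by rewrite (_ : lift ord0 (lift ord0 ord0) = o2); last exact: val_inj.
Qed.

Lemma nsq_sphere (v : sphere R) : nsq (val v) = 1.
Proof. by rewrite -nsqE; have := set_mem (valP v). Qed.

Lemma nsqZ a v : nsq (a *: v) = a ^+ 2 * nsq v.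
Proof. by rewrite /nsq !cE; ring. Qed.

Lemma nsq_gt0 v : v != 0 -> 0 < nsq v.
Proof.
move=> v0; rewrite lt_def !addr_ge0 ?sqr_ge0 ?andbT //.
apply: contra v0 => /eqP n0; apply/eqP.
move: n0; rewrite /nsq => n0.
by apply: vec_eq; rewrite !cE; nra.
Qed.

Definition e1 : vec := row3 1 0 0.

Lemma e1_neq0 : e1 != 0.
Proof.
by apply/eqP => /(congr1 cx); rewrite !cE => /eqP; rewrite oner_eq0.
Qed.

Definition unit_rep (v : vec) : vec :=
  if v == 0 then e1 else (Num.sqrt (nsq v))^-1 *: v.

Lemma unit_rep_sphere v : unit_rep v \in @unit_sphere R 3.
Proof.
apply/mem_set; rewrite /unit_sphere /= nsqE /unit_rep.
case: ifPn => v0; first by rewrite /nsq !cE; ring.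
by rewrite nsqZ exprVn sqr_sqrtr ?ltW ?nsq_gt0// mulVf// gt_eqF ?nsq_gt0.
Qed.

(* The junk value at [0] is [(1,0,0)]. *)
Definition radial (v : vec) : sphere R :=
  exist _ (unit_rep v) (unit_rep_sphere v).

Lemma val_radial v : v != 0 -> exists2 a, 0 < a & val (radial v) = a *: v.
Proof.
move=> v0; exists (Num.sqrt (nsq v))^-1.
  by rewrite invr_gt0 sqrtr_gt0 nsq_gt0.
by rewrite /= /unit_rep (negbTE v0).
Qed.

Lemma sphere_neq0 (v : sphere R) : val v != 0.
Proof.
apply/eqP => v0; have := nsq_sphere v.
by rewrite v0 /nsq !cE => /eqP; rewrite !expr0n /= !addr0 eq_sym oner_eq0.
Qed.

Lemma radialZ a v : 0 < a -> v != 0 -> radial (a *: v) = radial v.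
Proof.
move=> a0 v0; apply: val_inj; rewrite /= /unit_rep scaler_eq0 (gt_eqF a0) /=.
rewrite (negbTE v0) nsqZ sqrtrM ?sqr_ge0// sqrtr_sqr gtr0_norm//.
by rewrite scalerA invfM mulrAC mulVf ?mul1r ?gt_eqF.
Qed.

Lemma radial_val (v : sphere R) : radial (val v) = v.
Proof.
apply: val_inj; rewrite /= /unit_rep (negbTE (sphere_neq0 v)) nsq_sphere.
by rewrite sqrtr1 invr1 scale1r.
Qed.

Lemma continuous_nsq : continuous nsq.
Proof.
by move=> v; have [? ? ?] := And3 (@continuous_cx v) (@continuous_cy v)
  (@continuous_cz v); rewrite /nsq; solve_continuous.
Qed.

Lemma vec_neq0_near (v : vec) : v != 0 -> \forall w \near v, w != 0.
Proof.
move=> v0; have /cvgr_gt /(_ _ (nsq_gt0 v0)) := @continuous_nsq v.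
apply: filterS => w; apply: contraTN => /eqP ->.
by rewrite /nsq !cE !expr0n /= !addr0 ltxx.
Qed.

Lemma continuous_radial (v : vec) : v != 0 -> {for v, continuous radial}.
Proof.
move=> v0; apply: continuous_at_into_set_type.
apply: (@continuous_at_congr _ _ (fun v => (Num.sqrt (nsq v))^-1 *: v)).
  apply: filterS (vec_neq0_near v0) => w w0 /=.
  by rewrite /unit_rep (negbTE w0).
apply: continuousZ; last exact: cvg_id.
apply: continuousV; first by rewrite gt_eqF// sqrtr_gt0 nsq_gt0.
exact: (continuous_cvg _ (@sqrt_continuous _ _) (@continuous_nsq v)).
Qed.

(** The unit sphere is closed and bounded in R^3; its compactness passes to the subspace type as the
    image under [radial], which is continuous away from 0. *)
Lemma compact_sphere : compact [set: sphere R].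
Proof.
have -> : [set: sphere R] = radial @` @unit_sphere R 3.
  apply/seteqP; split=> // v _; exists (val v); last exact: radial_val.
  exact: set_mem (valP v).
apply: continuous_compact.
  apply: continuous_in_subspaceT => v /set_mem v1; apply: continuous_radial.
  apply: contraTneq isT => v0; move: v1.
  rewrite v0 /unit_sphere /= nsqE /nsq !cE.
  by move=> /eqP; rewrite !expr0n /= !addr0 eq_sym oner_eq0.
apply: bounded_closed_compact.
  exists 1; split; first exact: num_real.
  move=> M M1 v; rewrite /unit_sphere /= nsqE => v1.
  apply: le_trans (ltW M1).
  rewrite [leLHS]/Num.norm /= mx_normrE.
  apply/bigmax_leP; split => // -[i j] _ /=.
  rewrite ord1 -(expr_le1 (n := 2))// real_normK ?num_real// -v1 -nsqE.
  by rewrite (bigD1 j)//= lerDl sumr_ge0// => k _; rewrite sqr_ge0.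
rewrite (_ : @unit_sphere R 3 = nsq @^-1` [set 1]).
  apply: closed_comp => [v _|]; first exact: continuous_nsq.
  exact: closed_eq.
by apply/seteqP; split=> v; rewrite /unit_sphere /= nsqE.
Qed.

End Space.

(** * Homogeneous maps and tame disks *)

(** Total maps with continuity only at the points of [A] and of [B]: the collapse of a disk and its
    inverse are controlled only off the disk and off a point. *)
Lemma homeomorphic_sub (X : topologicalType) (A B : set X) (f g : X -> X) :
  (forall x, A x -> [/\ B (f x), continuous_at x f & g (f x) = x]) ->
  (forall x, B x -> [/\ A (g x), continuous_at x g & f (g x) = x]) ->
  homeomorphic (set_type A) (set_type B).
Proof.
move=> fP gP.
have fAB (a : set_type A) : f (val a) \in B.
  by apply/mem_set; have [] := fP _ (set_mem (valP a)).
have gBA (b : set_type B) : g (val b) \in A.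
  by apply/mem_set; have [] := gP _ (set_mem (valP b)).
exists (fun a => exist (fun x => x \in B) (f (val a)) (fAB a)),
  (fun b => exist (fun x => x \in A) (g (val b)) (gBA b)); split.
- move=> a; apply: continuous_at_into_set_type => /=.
  apply: (@continuous_comp _ _ _ (fun a : set_type A => val a) f).
    exact: continuous_val.
  by have [] := fP _ (set_mem (valP a)).
- move=> b; apply: continuous_at_into_set_type => /=.
  apply: (@continuous_comp _ _ _ (fun b : set_type B => val b) g).
    exact: continuous_val.
  by have [] := gP _ (set_mem (valP b)).
- by move=> a; apply: val_inj => /=; have [] := fP _ (set_mem (valP a)).
- by move=> b; apply: val_inj => /=; have [] := gP _ (set_mem (valP b)).
Qed.

Lemma homeomorphic_trans (X Y Z : topologicalType) :
  homeomorphic X Y -> homeomorphic Y Z -> homeomorphic X Z.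
Proof.
move=> [f [g [cf cg fK gK]]] [f' [g' [cf' cg' fK' gK']]].
exists (f' \o f), (g \o g'); split.
- by move=> x; apply: continuous_comp; [exact: cf | exact: cf'].
- by move=> x; apply: continuous_comp; [exact: cg' | exact: cg].
- by move=> x /=; rewrite fK' fK.
- by move=> x /=; rewrite gK gK'.
Qed.

Section RadialMaps.
Variable R : realType.
Local Notation vec := 'rV[R]_3.
Implicit Types (F G : vec -> vec) (v : vec) (p q : sphere R).

(** Enough for a map to descend to the sphere; the factor is left free because the collapse below
    has degree 2. *)
Definition ray_map F :=
  forall a v, 0 < a -> exists2 b, 0 < b & F (a *: v) = b *: F v.

Definition homogeneous F := forall a v, 0 < a -> F (a *: v) = a *: F v.

Lemma homogeneous_ray_map F : homogeneous F -> ray_map F.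
Proof. by move=> hF a v a0; exists a => //; exact: hF. Qed.

Definition radial_map F p : sphere R := radial (F (val p)).

Lemma continuous_radial_map F p :
  F (val p) != 0 -> continuous_at (val p) F ->
  continuous_at p (radial_map F).
Proof.
move=> F0 cF.
apply: (@continuous_comp _ _ _ (fun q : sphere R => F (val q)) (@radial R)).
  apply: (@continuous_comp _ _ _ (fun q : sphere R => val q) F) => //.
  exact: continuous_val.
exact: continuous_radial.
Qed.

Lemma radial_mapK F G p a :
  ray_map G -> F (val p) != 0 -> 0 < a -> G (F (val p)) = a *: val p ->
  radial_map G (radial_map F p) = p.
Proof.
move=> rG F0 a0 GF; rewrite /radial_map.
have [b b0 ->] := val_radial F0.
have [c c0 ->] := rG _ (F (val p)) b0.
by rewrite GF scalerA radialZ ?mulr_gt0 ?sphere_neq0// radial_val.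
Qed.

Lemma sgr_cx_radial v : v != 0 -> (0 <= cx (val (radial v))) = (0 <= cx v).
Proof. by move=> /val_radial[a a0 ->]; rewrite cE pmulr_rge0. Qed.

Lemma cx_radial_eq0 v : v != 0 -> (cx (val (radial v)) == 0) = (cx v == 0).
Proof. by move=> /val_radial[a a0 ->]; rewrite cE mulf_eq0 gt_eqF. Qed.

Lemma val_radial_unit v : nsq v = 1 -> val (radial v) = v.
Proof.
move=> v1; rewrite /= /unit_rep; case: ifPn => [/eqP v0|_].
  by have /eqP := v1; rewrite v0 /nsq !cE expr0n /= !addr0 eq_sym oner_eq0.
by rewrite v1 sqrtr1 invr1 scale1r.
Qed.

(** Homogeneity is asked of [F] alone, since the inverse inherits it. *)
Definition homogeneous_homeo F := exists G,
  [/\ continuous F, continuous G, homogeneous F, cancel F G & cancel G F].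

Lemma homogeneous0 F : homogeneous F -> F 0 = 0.
Proof.
move=> hF; have := hF 2 0 (ltr0n _ 2).
by rewrite scaler0 scaler_nat mulr2n -{1}[F 0]addr0 => /addrI.
Qed.

Lemma homogeneous_homeo_neq0 F v :
  homogeneous_homeo F -> v != 0 -> F v != 0.
Proof.
move=> [G [_ _ /homogeneous0 F0 FK _]]; apply: contra => /eqP Fv.
by rewrite -(inj_eq (can_inj FK)) Fv F0.
Qed.

Lemma homogeneous_homeo_comp F F' :
  homogeneous_homeo F -> homogeneous_homeo F' -> homogeneous_homeo (F' \o F).
Proof.
move=> [G [cF cG hF FK GK]] [G' [cF' cG' hF' FK' GK']].
exists (G \o G'); split.
- by move=> x; apply: continuous_comp; [exact: cF | exact: cF'].
- by move=> x; apply: continuous_comp; [exact: cG' | exact: cG].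
- by move=> a v a0 /=; rewrite hF// hF'.
- by move=> x /=; rewrite FK' FK.
- by move=> x /=; rewrite GK GK'.
Qed.

Definition self_homeo (h g : sphere R -> sphere R) :=
  [/\ continuous h, continuous g, cancel h g & cancel g h].

(** A closed disk with its bounding circle. The homeomorphism is one of the whole sphere, so the
    complement of the disk can be transported to an open hemisphere as well. *)
Definition tame_disk (D C : set (sphere R)) := exists h g,
  [/\ self_homeo h g, D = [set p | 0 <= cx (val (h p))]
    & C = [set p | cx (val (h p)) = 0]].

Lemma homogeneous_tame_disk F : homogeneous_homeo F ->
  tame_disk [set p | 0 <= cx (F (val p))] [set p | cx (F (val p)) = 0].
Proof.
move=> hhF; have [G [cF cG hF FK GK]] := hhF.
have hG : homogeneous G.
  by move=> a v a0; rewrite -{1}(GK v) -hF// FK.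
have hhG : homogeneous_homeo G by exists F.
have F0 p : F (val p) != 0 by apply: homogeneous_homeo_neq0 (sphere_neq0 p).
have G0 p : G (val p) != 0 by apply: homogeneous_homeo_neq0 (sphere_neq0 p).
exists (radial_map F), (radial_map G); split.
- split.
  + by move=> p; apply: continuous_radial_map.
  + by move=> p; apply: continuous_radial_map.
  + move=> p; apply: (@radial_mapK F G p 1); rewrite ?scale1r//.
    exact: homogeneous_ray_map.
  + move=> p; apply: (@radial_mapK G F p 1); rewrite ?scale1r//.
    exact: homogeneous_ray_map.
- by apply/seteqP; split=> p; rewrite /mkset /radial_map sgr_cx_radial.
- apply/seteqP; split=> p; rewrite /mkset /radial_map => /eqP.
    by rewrite -cx_radial_eq0// => /eqP.
  by rewrite cx_radial_eq0// => /eqP.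
Qed.

End RadialMaps.

(** * Connectedness of punctured disks *)

Section Moment.
Variable R : realType.
Local Notation vec := 'rV[R]_3.

(** The inner product of [v] with the point [(1, t, t^2)] of the moment curve. *)
Definition moment (t : R) (v : vec) : R := cx v + t * cy v + t ^+ 2 * cz v.

(** For [v != 0] the moment is a nonzero polynomial in [t]; the product of these finitely many
    polynomials has a non-root. *)
Lemma exists_moment_neq0 (l : seq vec) :
  exists t, forall v, v \in l -> v != 0 -> moment t v != 0.
Proof.
pose pl (v : vec) : {poly R} := Poly [:: cx v; cy v; cz v].
have plE v t : (pl v).[t] = moment t v.
  by rewrite horner_Poly /= /moment mul0r add0r; ring.
have pl0 v : v != 0 -> pl v != 0.
  apply: contra => /eqP e; apply/eqP.
  by apply: vec_eq; rewrite cE;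
    [move/(congr1 (fun p : {poly R} => p`_0)): e
    |move/(congr1 (fun p : {poly R} => p`_1)): e
    |move/(congr1 (fun p : {poly R} => p`_2)): e]; rewrite coef_Poly coef0.
pose P := \prod_(v <- l | v != 0) pl v.
have P0 : P != 0 by rewrite prodf_seq_neq0; apply/allP => v _; apply/implyP/pl0.
have [t Pt] : exists t, ~~ root P t.
  apply/not_existsP => H.
  pose s := [seq k%:R : R | k <- iota 0 (size P)].
  have us : uniq s.
    rewrite map_inj_uniq ?iota_uniq// => a b /eqP.
    by rewrite eqr_nat => /eqP.
  have rs : all (root P) s.
    by apply/allP => t _; apply: contrapT => /negP; exact: H.
  by have := max_poly_roots P0 rs us; rewrite size_map size_iota ltnn.
exists t => v vl v0; apply: contra Pt => /eqP mv.
rewrite /P rootE horner_prod prodf_seq_eq0; apply/hasP; exists v => //.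
by rewrite v0 plE mv eqxx.
Qed.

Definition cross (u v : vec) : vec :=
  row3 (cy u * cz v - cz u * cy v) (cz u * cx v - cx u * cz v)
       (cx u * cy v - cy u * cx v).

(** The product with the first basis vector contains [cy u] and [cz u] up to sign, the product with
    the second one contains [cx u]. *)
Lemma cross_basis_neq0 (u : vec) : u != 0 ->
  exists2 e, e \in [:: row3 1 0 0; row3 0 1 0] & cross u e != 0.
Proof.
move=> u0; apply: contrapT => H.
have H1 e : e \in [:: row3 1 0 0; row3 0 1 0] -> cross u e = 0.
  by move=> el; apply/eqP/negPn/negP => ce; apply: H; exists e.
have A := H1 (row3 1 0 0); have B := H1 (row3 0 1 0).
move: A; rewrite !inE eqxx => /(_ isT) A.
move: B; rewrite !inE eqxx orbT => /(_ isT) B.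
have A1 := congr1 (@cy R) A; have A2 := congr1 (@cz R) A.
have B2 := congr1 (@cz R) B; rewrite !cE in A1 A2 B2.
move/eqP: u0; apply; apply: vec_eq; rewrite !cE; lra.
Qed.

End Moment.

Section Hemisphere.
Variable R : realType.
Local Notation vec := 'rV[R]_3.

Lemma continuous_segment (u v : vec) :
  continuous (fun t : R => (1 - t) *: u + t *: v).
Proof.
move=> t; rewrite (_ : (fun _ => _) = fun t : R =>
  row3 ((1 - t) * cx u + t * cx v) ((1 - t) * cy u + t * cy v)
       ((1 - t) * cz u + t * cz v)); last first.
  by apply/funext => s; apply: vec_eq; rewrite !cE.
have ? : continuous_at t (fun t : R => t) by [].
by apply: continuous_row3; solve_continuous.
Qed.

Lemma connected_arc (u v : vec) :
  (forall t, 0 <= t <= 1 -> (1 - t) *: u + t *: v != 0) ->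
  connected [set radial ((1 - t) *: u + t *: v) | t in `[0, 1]].
Proof.
move=> nz; apply: connected_continuous_connected.
  exact: segment_connected.
apply: continuous_in_subspaceT => t /set_mem /=; rewrite in_itv /= => t01.
apply: (@continuous_comp _ _ _ (fun t : R => (1 - t) *: u + t *: v)).
  exact: continuous_segment.
exact/continuous_radial/nz.
Qed.

(* A generic point [z] of the moment curve is joined to [x] and to [y] by arcs
   which avoid the finite set [Q]. *)
Lemma connected_hemisphere_minus (Q : set (sphere R)) : finite_set Q ->
  connected ([set p : sphere R | 0 <= cx (val p)] `\` Q).
Proof.
move=> /finite_seqP[l ->]; set A := _ `\` _.
have join x y : A x -> A y -> exists B,
    [/\ B x, B y, B `<=` A & connected B].
  move=> Ax Ay.
  (* The moment of [cross w q] is the determinant of [w], [q] and [z]: the first vectors keep [z]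
     off the planes spanned by [w] and a point of [Q], the last two keep [z] off the line of [w]. *)
  pose test (w : vec) := [seq cross w (val q) | q <- l] ++
    [seq cross w e | e <- [:: row3 1 0 0; row3 0 1 0]].
  have [t tP] := exists_moment_neq0 (test (val x) ++ test (val y)).
  pose z : vec := row3 1 t (t ^+ 2).
  have arcP w : A w -> (forall v, v \in test (val w) -> v != 0 ->
        moment t v != 0) ->
      (forall s, 0 <= s <= 1 -> (1 - s) *: val w + s *: z != 0) /\
      [set radial ((1 - s) *: val w + s *: z) | s in `[0, 1]] `<=` A.
    move=> [w0 wl] wP.
    (* The first coordinate is 1 for [z] and nonnegative for [w], so the segment could only vanish
       at [s = 0], where it equals [w]. *)
    have nz s : 0 <= s <= 1 -> (1 - s) *: val w + s *: z != 0.
      have {}w0 : 0 <= cx (val w) := w0.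
      move=> /andP[s0 s1]; apply/eqP => e.
      have := congr1 (@cx R) e; rewrite !cE => ex.
      have s00 : s = 0 by nra.
      move: e; rewrite s00 subr0 scale1r scale0r addr0 => /eqP.
      by rewrite (negbTE (sphere_neq0 _)).
    split=> // y0 [s s_in <-{y0}].
    have s01 : 0 <= s <= 1 by move: s_in; rewrite /= in_itv.
    have [b b0 be] := val_radial (nz _ s01); split.
      rewrite /mkset sgr_cx_radial ?nz// !cE.
      by move/andP: s01 => [s0 s1]; rewrite addr_ge0 ?mulr_ge0// subr_ge0.
    set q := radial _ => ql; have {}ql : q \in l := ql.
    have crq : cross (val w) (val q) = 0.
      apply/eqP/negPn/negP => c0.
      have := wP (cross (val w) (val q)).
      rewrite mem_cat (map_f (fun q => cross (val w) (val q)) ql).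
      move=> /(_ isT c0) /eqP; apply.
      rewrite be /moment !cE; ring.
    have [e el ce] := cross_basis_neq0 (sphere_neq0 w).
    have := wP (cross (val w) e).
    rewrite mem_cat (map_f (cross (val w)) el) orbT.
    move=> /(_ isT ce) me.
    (* An arc point in [Q] is parallel to [w]; for [s != 0] this would make [z] parallel to [w],
       against the choice of [t]. *)
    have s0 : s = 0.
      apply/eqP/negPn/negP => sN0.
      have bs : b * s != 0 by rewrite mulf_neq0// gt_eqF.
      have := congr1 (@cx R) crq; have := congr1 (@cy R) crq.
      have := congr1 (@cz R) crq; rewrite /q be !cE => h3 h2 h1.
      have g1 : (b * s) * (cy (val w) * t ^+ 2 - cz (val w) * t) = 0.
        by rewrite -h1; ring.
      have g2 : (b * s) * (cz (val w) - cx (val w) * t ^+ 2) = 0.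
        by rewrite -h2; ring.
      have g3 : (b * s) * (cx (val w) * t - cy (val w)) = 0.
        by rewrite -h3; ring.
      have bsI c : b * s * c = 0 -> c = 0.
        by move/eqP; rewrite mulf_eq0 (negbTE bs) => /eqP.
      move: g1 g2 g3 => /bsI g1 /bsI g2 /bsI g3.
      move/eqP: me; apply; rewrite /moment !cE.
      transitivity (cx e * (cy (val w) * t ^+ 2 - cz (val w) * t) * (-1)
        + cy e * (cz (val w) - cx (val w) * t ^+ 2) * (-1)
        + cz e * (cx (val w) * t - cy (val w)) * (-1)); first by ring.
      by rewrite g1 g2 g3; ring.
    apply: wl; move: ql; rewrite /q s0 subr0 scale1r scale0r addr0.
    by rewrite radial_val.
  have [|nx ax] := arcP x Ax.
    by move=> v vx; apply: tP; rewrite mem_cat vx.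
  have [|ny ay] := arcP y Ay.
    by move=> v vy; apply: tP; rewrite mem_cat vy orbT.
  exists ([set radial ((1 - s) *: val x + s *: z) | s in `[0, 1]] `|`
          [set radial ((1 - s) *: val y + s *: z) | s in `[0, 1]]); split.
  - left; exists 0; first by rewrite /= in_itv /= lexx ler01.
    by rewrite subr0 scale1r scale0r addr0 radial_val.
  - right; exists 0; first by rewrite /= in_itv /= lexx ler01.
    by rewrite subr0 scale1r scale0r addr0 radial_val.
  - by rewrite subUset.
  - apply: connectedU; [|exact: connected_arc|exact: connected_arc].
    exists (radial z); split; exists 1; rewrite /= ?in_itv/= ?lexx ?ler01//.
    + by rewrite subrr scale0r add0r scale1r.
    + by rewrite subrr scale0r add0r scale1r.
have [->|[x Ax]] : A = set0 \/ A !=set0.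
  by have [|/set0P] := eqVneq A set0; auto.
  exact: connected0.
suff -> : A = connected_component A x by exact: component_connected.
apply/seteqP; split; last exact: connected_component_sub.
move=> y Ay; have [B [Bx By BA Bc]] := join x y Ax Ay.
by exists B.
Qed.

End Hemisphere.

(** * Collapsing a disk *)

Section Collapse.
Variable R : realType.
Local Notation vec := 'rV[R]_3.
Variable d : R.
Hypothesis d0 : 0 < d.

Definition rho2 (v : vec) : R := cy v ^+ 2 + cz v ^+ 2.

(* In the slope [k = x / rho < 0], [collapse] is, up to the positive factor
   [- x], the map [k |-> max k (2 k - d^2 / k)]: the identity for [k <= - d],
   and a homeomorphism from the negative reals onto the reals. *)
Definition collapse (v : vec) : vec :=
  row3 (Num.max (- cx v ^+ 2) (d ^+ 2 * rho2 v - 2 * cx v ^+ 2))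
       (- cx v * cy v) (- cx v * cz v).

(** The second argument of the minimum is the negative root [k] of [2 k^2 - K k - d^2 = 0], where
    [K] is the slope of [v], multiplied by [rho]; the minimum inverts the maximum in [collapse]. *)
Definition uncollapse (v : vec) : vec :=
  row3 (Num.min (cx v)
          ((cx v - Num.sqrt (cx v ^+ 2 + 8 * d ^+ 2 * rho2 v)) / 4))
       (cy v) (cz v).

Lemma rho2_ge0 v : 0 <= rho2 v.
Proof. by rewrite addr_ge0 ?sqr_ge0. Qed.

Lemma rho2Z a v : rho2 (a *: v) = a ^+ 2 * rho2 v.
Proof. by rewrite /rho2 !cE; ring. Qed.

Lemma rho2_eq0 v : rho2 v = 0 -> cy v = 0 /\ cz v = 0.
Proof. by rewrite /rho2 => h; split; nra. Qed.

Lemma collapse_ray : ray_map collapse.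
Proof.
move=> a v a0; exists (a ^+ 2); first by rewrite exprn_gt0.
apply: vec_eq; rewrite !cE ?rho2Z; [|ring|ring].
by rewrite maxr_pMr ?sqr_ge0//; congr (Num.max _ _); ring.
Qed.

Lemma uncollapse_ray : ray_map uncollapse.
Proof.
move=> a v a0; exists a => //.
apply: vec_eq; rewrite !cE // ?rho2Z minr_pMr ?(ltW a0)//.
congr (Num.min _ _).
rewrite (_ : (a * cx v) ^+ 2 + _ =
  a ^+ 2 * (cx v ^+ 2 + 8 * d ^+ 2 * rho2 v)); last by ring.
by rewrite sqrtrM ?sqr_ge0// sqrtr_sqr gtr0_norm//; ring.
Qed.

Lemma continuous_collapse : continuous collapse.
Proof.
move=> v; have [? ? ?] := And3 (@continuous_cx R v) (@continuous_cy R v)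
  (@continuous_cz R v).
by apply: continuous_row3; rewrite /rho2; solve_continuous.
Qed.

Lemma continuous_uncollapse : continuous uncollapse.
Proof.
move=> v; have [? ? ?] := And3 (@continuous_cx R v) (@continuous_cy R v)
  (@continuous_cz R v).
by apply: continuous_row3; rewrite /rho2; solve_continuous.
Qed.

(** The two bounds make the slope at most [- d]; on the unit sphere the second one always holds. *)
Lemma collapse_near v : cx v <= - d -> rho2 v <= 1 -> collapse v = - cx v *: v.
Proof.
have dp := d0; move=> vd r1; have r0 := rho2_ge0 v.
apply: vec_eq; rewrite !cE //.
rewrite max_l; first by ring.
have h1 : d ^+ 2 <= cx v ^+ 2.
  by rewrite -(sqrrN (cx v)) ler_pXn2r ?nnegrE//; lra.
have : d ^+ 2 * rho2 v <= d ^+ 2 by rewrite ler_piMr ?sqr_ge0.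
lra.
Qed.

Lemma sqrtr_eq (a b : R) : 0 <= a -> b = a ^+ 2 -> Num.sqrt b = a.
Proof. by move=> a0 ->; rewrite sqrtr_sqr ger0_norm. Qed.

Lemma collapseK v : cx v < 0 -> uncollapse (collapse v) = - cx v *: v.
Proof.
move=> x0; have r0 := rho2_ge0 v.
apply: vec_eq; rewrite !cE //.
have -> : rho2 (collapse v) = cx v ^+ 2 * rho2 v.
  by rewrite /rho2 !cE; ring.
case: (lerP (d ^+ 2 * rho2 v) (cx v ^+ 2)) => h.
- rewrite max_l; last by lra.
  rewrite min_l; first by ring.
  set s := Num.sqrt _.
  have : s <= 3 * cx v ^+ 2.
    have e : 0 <= 3 * cx v ^+ 2 by rewrite mulr_ge0 ?sqr_ge0.
    rewrite -(ger0_norm e) -sqrtr_sqr ler_wsqrtr//.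
    by have := ler_wpM2l (sqr_ge0 (cx v)) h; lra.
  by rewrite ler_pdivlMr//; lra.
- rewrite max_r; last by lra.
  (* The discriminant is a perfect square: [(d^2 rho2 - 2 x^2)^2 + 8 d^2 x^2 rho2 = (d^2 rho2 + 2
     x^2)^2]. *)
  rewrite (@sqrtr_eq (d ^+ 2 * rho2 v + 2 * cx v ^+ 2)); last first.
  + by ring.
  + by have := mulr_ge0 (sqr_ge0 d) r0; have := sqr_ge0 (cx v); lra.
  rewrite min_r; last by rewrite ler_pdivrMr//; lra.
  by field.
Qed.

(** Hence no point of the open hemisphere [x < 0] is sent to the pole [e1], the point onto which the
    disk is collapsed. *)
Lemma cx_collapse_lt0 v : cx v < 0 ->
  cy (collapse v) = 0 -> cz (collapse v) = 0 -> cx (collapse v) < 0.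
Proof.
move=> x0; have x1 : - cx v != 0 by rewrite oppr_eq0 lt_eqF.
rewrite !cE => /eqP; rewrite mulf_eq0 (negbTE x1) => /eqP y0 /eqP.
rewrite mulf_eq0 (negbTE x1) => /eqP z0.
have : 0 < cx v ^+ 2 by rewrite exprn_even_gt0//= lt_eqF.
rewrite gt_max /rho2 y0 z0 expr0n /= addr0 mulr0 => ?.
by apply/andP; split; lra.
Qed.

Lemma cx_uncollapse_lt0 v : v != 0 -> ~ [/\ cy v = 0, cz v = 0 & 0 < cx v] ->
  cx (uncollapse v) < 0.
Proof.
move=> v0 nv; rewrite !cE gt_min; have r0 := rho2_ge0 v.
case: (ltP (cx v) 0) => //= x0.
have r1 : 0 < rho2 v.
  rewrite lt_def r0 andbT; apply: contra_notN nv => /eqP /rho2_eq0[y z].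
  split=> //; rewrite lt_def x0 andbT; apply: contra v0 => /eqP x.
  by apply/eqP; apply: vec_eq; rewrite cE.
rewrite ltr_pdivrMr// mul0r subr_lt0 -{1}(ger0_norm x0) -sqrtr_sqr ltr_sqrt.
  by rewrite ltrDl !mulr_gt0// exprn_gt0.
by rewrite ltr_wpDl ?sqr_ge0 ?mulr_gt0 ?exprn_gt0.
Qed.

Lemma uncollapseK v : cx (uncollapse v) < 0 ->
  collapse (uncollapse v) = - cx (uncollapse v) *: v.
Proof.
move=> g0; have r0 := rho2_ge0 v.
have rE : rho2 (uncollapse v) = rho2 v by rewrite /rho2 !cE.
apply: vec_eq; rewrite [LHS](cx_row3, cy_row3, cz_row3) [RHS](cyZ, czZ, cxZ);
  [|by rewrite cy_row3|by rewrite cz_row3].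
have e0 : 0 <= cx v ^+ 2 + 8 * d ^+ 2 * rho2 v.
  by have := mulr_ge0 (sqr_ge0 d) r0; have := sqr_ge0 (cx v); lra.
move: g0; rewrite rE cx_row3.
set s := Num.sqrt _.
have s0 : 0 <= s by exact: sqrtr_ge0.
have s2 : s ^+ 2 = cx v ^+ 2 + 8 * d ^+ 2 * rho2 v by rewrite sqr_sqrtr.
case: (lerP (cx v) ((cx v - s) / 4)) => h x0.
- rewrite max_l; first by ring.
  have : s <= - 3 * cx v by move: h; rewrite ler_pdivlMr//; lra.
  nra.
- have h' : cx v - s < 4 * cx v by move: h; rewrite ltr_pdivrMr//; lra.
  have x1 : cx v - s < 0 by move: x0; rewrite ltr_pdivrMr//; lra.
  (* This is the quadratic equation whose root defines [uncollapse]. *)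
  have q : d ^+ 2 * rho2 v - 2 * ((cx v - s) / 4) ^+ 2
    = - ((cx v - s) / 4) * cx v.
    transitivity ((s ^+ 2 - cx v ^+ 2) / 8 - 2 * ((cx v - s) / 4) ^+ 2).
      by rewrite s2; field.
    by field.
  rewrite max_r q//.
  nra.
Qed.

End Collapse.

(** * Topology of tame disks *)

Section TameDisks.
Variable R : realType.
Local Notation vec := 'rV[R]_3.
Implicit Types (D C A Q : set (sphere R)).

Lemma continuous_cx_val : continuous (fun p : sphere R => cx (val p)).
Proof.
move=> p; apply: (@continuous_comp _ _ _ (fun q : sphere R => val q) (@cx R)).
  exact: continuous_val.
exact: continuous_cx.
Qed.

Lemma continuous_cx_comp (h : sphere R -> sphere R) : continuous h ->
  continuous (fun p : sphere R => cx (val (h p))).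
Proof.
move=> ch p.
apply: (@continuous_comp _ _ _ h (fun q : sphere R => cx (val q))).
  exact: ch.
exact: continuous_cx_val.
Qed.

Lemma tame_disk_closed D C : tame_disk D C -> closed D.
Proof.
move=> [h [g [[ch _ _ _] -> _]]].
rewrite (_ : [set p | _] = (fun p => cx (val (h p))) @^-1` [set x | 0 <= x])//.
by apply: closed_comp => [p _|]; [exact: continuous_cx_comp|exact: closed_ge].
Qed.

Lemma tame_circle_sub D C : tame_disk D C -> C `<=` D.
Proof. by move=> [h [g [_ -> ->]]] p /= ->. Qed.

Lemma tame_disk_nbhs D C p : tame_disk D C -> D p -> ~ C p -> nbhs p D.
Proof.
move=> [h [g [[ch _ _ _] -> ->]]] /= Dp /eqP Cp.
have : 0 < cx (val (h p)) by rewrite lt_def Cp.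
have /cvgr_gt H := @continuous_cx_comp h ch p.
by move=> /H; apply: filterS => q /ltW.
Qed.

Lemma tame_circle_neq0 D C : tame_disk D C -> C !=set0.
Proof.
move=> [h [g [[_ _ _ gK] _ ->]]].
exists (g (radial (row3 0 1 0))); rewrite /= gK.
have nz : row3 0 1 0 != 0 :> vec.
  by apply/eqP => /(congr1 (@cy R)); rewrite !cE => /eqP; rewrite oner_eq0.
by apply/eqP; rewrite cx_radial_eq0// cE.
Qed.

(** After applying [h], the point lies on the equator and is approached by the projections of
    [(- t, y, z)] with [t > 0], which lie outside the hemisphere. *)
Lemma tame_circle_limit D C p : tame_disk D C -> C p -> closure (~` D) p.
Proof.
move=> [h [g [[ch cg hK gK] -> ->]]] Cp U Up.
have {}Cp : cx (val (h p)) = 0 := Cp.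
pose w := val (h p).
pose path (t : R) := row3 (- t) (cy w) (cz w).
have path0 : path 0 = w.
  by apply: vec_eq; rewrite /path !cE ?oppr0.
have pathN t : path t != 0.
  apply/eqP => e; have := congr1 (@cy R) e; have := congr1 (@cz R) e.
  rewrite /path !cE => z0 y0; have /eqP := sphere_neq0 (h p); apply.
  by apply: vec_eq; rewrite !cE.
have cpath : continuous_at 0 (fun t => g (radial (path t))).
  apply: (@continuous_comp _ _ _ (fun t => radial (path t)) g); last exact: cg.
  apply: (@continuous_comp _ _ _ path (@radial R)).
    rewrite /path /prop_for; apply: continuous_row3;
      [|exact: continuous_at_cst..].
    exact: opp_continuous.
  exact/continuous_radial/pathN.
have : nbhs (g (radial (path 0))) U by rewrite path0 radial_val hK.
move=> /cpath /nbhs_ballP[e /= e0 eU].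
exists (g (radial (path (e / 2)))); split; last first.
  apply: eU; rewrite /ball /= sub0r normrN gtr0_norm ?divr_gt0//.
  by rewrite ltr_pdivrMr// ltr_pMr// ltr1n.
apply/negP; rewrite -ltNge gK ltNge sgr_cx_radial// cE -ltNge oppr_lt0.
exact: divr_gt0.
Qed.

Lemma tame_disk_connected D C Q : tame_disk D C -> finite_set Q ->
  connected (D `\` Q).
Proof.
move=> [h [g [[ch cg hK gK] -> _]]] fQ.
rewrite (_ : _ `\` _ = g @` ([set p | 0 <= cx (val p)] `\` (h @` Q))).
  apply: (@connected_continuous_connected (sphere R) (sphere R) _ g).
    exact/connected_hemisphere_minus/finite_image.
  exact: continuous_subspaceT.
apply/seteqP; split=> [p [Dp Qp]|_ [p [Dp Qp] <-]].
  exists (h p) => //; split=> // -[q Qq /(can_inj hK) qp].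
  by apply: Qp; rewrite -qp.
split; first by rewrite /= gK.
by move=> Qgp; apply: Qp; exists (g p).
Qed.

Lemma tame_circle_param D C : tame_disk D C ->
  exists gamma : circle R -> sphere R,
    [/\ continuous gamma, injective gamma & range gamma = C].
Proof.
move=> [h [g [[ch cg hK gK] _ ->]]].
pose j0 : 'I_2 := ord0; pose j1 : 'I_2 := lift ord0 ord0.
pose F (c : circle R) : vec := row3 0 (val c ord0 j0) (val c ord0 j1).
have F1 c : nsq (F c) = 1.
  have := set_mem (valP c).
  rewrite /unit_sphere /= big_ord_recl big_ord1 => <-.
  by rewrite /nsq !cE expr0n /= add0r.
have F0 c : F c != 0.
  apply/eqP => e; have /eqP := F1 c.
  by rewrite e /nsq !cE expr0n /= !addr0 eq_sym oner_eq0.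
exists (fun c => g (radial (F c))); split.
- move=> c; apply: (@continuous_comp _ _ _ (fun c => radial (F c)) g);
    last exact: cg.
  apply: (@continuous_comp _ _ _ F (@radial R)); last exact: continuous_radial.
  have cval i : continuous_at c (fun c : circle R => val c ord0 i).
    apply: (@continuous_comp _ _ _ (fun c : circle R => val c)
      (fun v : 'rV[R]_2 => v ord0 i)); first exact: continuous_val.
    exact: coord_continuous.
  by apply: continuous_row3; [exact: continuous_at_cst|exact: cval|exact: cval].
- move=> c c' /(can_inj gK) /(congr1 val).
  rewrite !val_radial_unit// => e; apply: val_inj; apply/rowP => i.
  have := congr1 (@cy R) e; have := congr1 (@cz R) e; rewrite !cE => e2 e1'.
  case: (unliftP ord0 i) => [k|] ->; last exact: e1'.
  by rewrite ord1; exact: e2.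
- apply/seteqP; split=> [_ [c _ <-]|p /= Cp].
    by rewrite /= gK; apply/eqP; rewrite cx_radial_eq0// cE.
  pose w := val (h p).
  pose c : 'rV[R]_2 := \row_i (if i == j0 then cy w else cz w).
  have c1 : c \in @unit_sphere R 2.
    apply/mem_set; rewrite /unit_sphere /= big_ord_recl big_ord1 !mxE /=.
    by have := nsq_sphere (h p); rewrite /nsq Cp expr0n /= add0r.
  exists (exist (fun c => c \in @unit_sphere R 2) c c1) => //.
  rewrite (_ : F _ = w) ?radial_val ?hK//.
  by apply: vec_eq; rewrite !cE ?Cp// !mxE.
Qed.

(** The image of [A] under [h] is compact and misses the hemisphere, so it lies in [x <= - d] for
    some [d > 0]. Conjugated by [h], the collapse with parameter [d] fixes [A] pointwise and sends
    the complement of [D] onto the complement of one point. *)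
Lemma tame_disk_collapse D C A : tame_disk D C -> closed A ->
  D `&` A = set0 ->
  exists2 p, D p & homeomorphic (set_type (~` (D `|` A)))
                                (set_type (~` ([set p] `|` A))).
Proof.
move=> [h [g [[ch cg hK gK] DE _]]] cA DA.
have [d d0 Ad] : exists2 d, 0 < d & forall p, A p -> cx (val (h p)) <= - d.
  have [A0|[a Aa]] : A = set0 \/ A !=set0.
    by have [|/set0P] := eqVneq A set0; auto.
    by exists 1 => // p; rewrite A0.
  have [|||c cA' cmax] := @compact_EVT_max _ R (fun p => cx (val (h p))) A.
  - by exists a.
  - exact: subclosed_compact cA (@compact_sphere R) _.
  - exact/continuous_subspaceT/continuous_cx_comp.
  (* The largest height on [A] is attained, and it is negative because [A] misses [D]. *)
  exists (- cx (val (h c))); last first.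
    by move=> p Ap; rewrite opprK; apply: cmax; exact/mem_set.
  rewrite oppr_gt0 ltNge; apply/negP => c0.
  have : (D `&` A) c by split; [rewrite DE|exact: set_mem].
  by rewrite DA.
have Ah p : A (g p) -> cx (val p) <= - d by move=> /Ad; rewrite gK.
have rho1 (p : sphere R) : rho2 (val p) <= 1.
  have := nsq_sphere p; rewrite /nsq /rho2.
  by have := sqr_ge0 (cx (val p)); lra.
have cN (p : sphere R) : cx (val p) < 0 -> collapse d (val p) != 0.
  move=> p0; apply/eqP => e; have := collapseK d p0; rewrite e => /eqP.
  rewrite eq_sym (_ : uncollapse d 0 = 0).
    by rewrite scaler_eq0 oppr_eq0 (lt_eqF p0) (negbTE (sphere_neq0 _)).
  apply: vec_eq; rewrite ?cy_row3 ?cz_row3 ?cx_row3 /rho2 !cE//.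
  by rewrite !expr0n /= !addr0 !mulr0 addr0 sqrtr0 subr0 mul0r minxx.
have eN (p : sphere R) : p <> radial (e1 R) -> cx (uncollapse d (val p)) < 0.
  move=> pe; apply: cx_uncollapse_lt0 => //; first exact: sphere_neq0.
  move=> [y0 z0 x0]; apply: pe; rewrite -[p]radial_val.
  rewrite -(radialZ (a := cx (val p)) (v := e1 R)) ?e1_neq0//.
  by congr radial; apply: vec_eq; rewrite !cE ?mulr1 ?mulr0.
have eN0 (p : sphere R) : p <> radial (e1 R) -> uncollapse d (val p) != 0.
  move=> /eN; apply: contraTneq => ->; by rewrite cE ltxx.
have colK (p : sphere R) : cx (val p) < 0 ->
    radial_map (uncollapse d) (radial_map (collapse d) p) = p.
  move=> p0; apply: (@radial_mapK R _ _ p (- cx (val p))).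
  - exact: uncollapse_ray.
  - exact: cN.
  - by rewrite oppr_gt0.
  - exact: collapseK.
have expK (p : sphere R) : p <> radial (e1 R) ->
    radial_map (collapse d) (radial_map (uncollapse d) p) = p.
  move=> p0; apply: (@radial_mapK R _ _ p (- cx (uncollapse d (val p)))).
  - exact: collapse_ray.
  - exact: eN0.
  - by rewrite oppr_gt0 eN.
  - exact/uncollapseK/eN.
have colA (p : sphere R) : cx (val p) <= - d -> radial_map (collapse d) p = p.
  move=> pd; rewrite /radial_map collapse_near// radialZ ?radial_val//.
    by rewrite oppr_gt0 (le_lt_trans pd)// oppr_lt0.
  exact: sphere_neq0.
have expA (p : sphere R) : cx (val p) <= - d -> radial_map (uncollapse d) p = p.
  move=> pd; rewrite -[in LHS](colA p pd) colK//.
  by rewrite (le_lt_trans pd)// oppr_lt0.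
have cxe1 : cx (val (radial (e1 R))) = 1.
  by rewrite val_radial_unit; rewrite ?/nsq !cE// expr0n /= !addr0 expr1n.
have expe1 (p : sphere R) : p <> radial (e1 R) ->
    cx (val (radial_map (uncollapse d) p)) < 0.
  by move=> pe; rewrite ltNge /radial_map sgr_cx_radial ?eN0// -ltNge eN.
exists (g (radial (e1 R))).
  by rewrite DE /= gK; rewrite cxe1.
apply: (@homeomorphic_sub _ _ _
  (fun p => g (radial_map (collapse d) (h p)))
  (fun p => g (radial_map (uncollapse d) (h p)))).
- move=> p /not_orP[Dp Ap].
  have p0 : cx (val (h p)) < 0 by rewrite ltNge; apply/negP; rewrite DE in Dp.
  split.
  + apply/not_orP; split=> [/(can_inj gK) e|Agp].
      have [b b0 be] := val_radial (cN _ p0).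
      have e2 : b *: collapse d (val (h p)) = e1 R.
        rewrite -be -/(radial_map _ _) e val_radial_unit//.
        by rewrite /nsq !cE expr0n /= !addr0 expr1n.
      have bI x : b * x = 0 -> x = 0.
        by move/eqP; rewrite mulf_eq0 gt_eqF//= => /eqP.
      have /(congr1 (@cx R)) := e2; rewrite cxZ [RHS]cx_row3 => ex.
      have /(congr1 (@cy R)) := e2; rewrite cyZ [RHS]cy_row3 => /bI ey.
      have /(congr1 (@cz R)) := e2; rewrite czZ [RHS]cz_row3 => /bI ez.
      have := cx_collapse_lt0 p0 ey ez.
      by rewrite -(pmulr_rlt0 _ b0) ex ltr10.
    (* An image point in [A] is fixed by the inverse map, so the original point was already in
       [A]. *)
    apply: Ap; have := Ah _ Agp => /expA; rewrite colK// => e.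
    by rewrite -e hK in Agp.
  + apply: continuous_comp; last exact: cg.
    apply: continuous_comp; first exact: ch.
    apply: continuous_radial_map; first exact: cN.
    exact: continuous_collapse.
  + by rewrite gK colK// hK.
- move=> p /not_orP[pe Ap].
  have {}pe : h p <> radial (e1 R) by move=> e; apply: pe; rewrite -e hK.
  split.
  + apply/not_orP; split=> [|Agp].
      by rewrite DE /= gK; apply/negP; rewrite -ltNge expe1.
    apply: Ap; have := Ah _ Agp => /colA; rewrite expK// => e.
    by rewrite -e hK in Agp.
  + apply: continuous_comp; last exact: cg.
    apply: continuous_comp; first exact: ch.
    apply: continuous_radial_map; first exact: eN0.
    exact: continuous_uncollapse.
  + by rewrite gK expK// hK.
Qed.

End TameDisks.

(** * Pants bounded by three disks *)

(** Within [A] the set [F] is closed, and also open as the complement of [G]; hence a component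
    meeting [F] stays inside it. *)
Lemma connected_component_piece (X : topologicalType) (A F G : set X) (x : X) :
  A `<=` F `|` G -> F `&` G = set0 -> closed F -> closed G ->
  connected (A `&` F) -> A x -> F x ->
  connected_component A x = A `&` F.
Proof.
move=> AFG FG cF cG cAF Ax Fx; apply/seteqP; split; last first.
  by apply: connected_component_max => // y [].
have KA := @connected_component_sub _ A x.
suff <- : connected_component A x `&` F = connected_component A x.
  by move=> y [/KA].
apply: (@component_connected _ A x).
- by exists x; split=> //; exact: connected_component_refl.
- exists (~` G); first exact: closed_openC.
  apply/seteqP; split=> y [Ky Fy]; split=> //.
    by move=> Gy; have : (F `&` G) y by []; rewrite FG.
  by have [|//] := AFG y (KA y Ky).
- by exists F.
Qed.

Lemma card_seq (T : choiceType) (s : seq T) : uniq s -> [set` s] #= `I_(size s).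
Proof.
case: s => [|x s] us; first by rewrite set_nil II0.
rewrite (_ : [set` _] = nth x (x :: s) @` `I_(size (x :: s))); last first.
  apply/seteqP; split=> [y ys|_ [i /= si <-]]; last exact: mem_nth.
  exists (index y (x :: s)); last exact: nth_index.
  by rewrite /mkset index_mem.
apply: inj_card_eq => i j /set_mem /= si /set_mem /= sj /eqP.
by rewrite nth_uniq// => /eqP.
Qed.

Section Pants.
Variable R : realType.
Implicit Types (D C A Q : set (sphere R)).

Lemma accessible_sphere : accessible_space (sphere R).
Proof.
move=> x y xy; exists (~` ((fun p : sphere R => val p) @^-1` [set val y])).
split.
- apply: closed_openC; apply: closed_comp => [p _|].
    exact: continuous_val.
  exact/accessible_closed_set1/hausdorff_accessible/norm_hausdorff.
- by rewrite inE /= => /val_inj e; move: xy; rewrite e eqxx.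
- by rewrite inE /= => H; exact: H.
Qed.

Lemma closed_finite_sphere A : finite_set A -> closed A.
Proof. by move: A; apply/accessible_finite_set_closed/accessible_sphere. Qed.

(** Otherwise the singleton of [p] would be open and closed in the connected set [D], hence equal to
    [D]; but [D] contains a circle that avoids [p]. *)
Lemma tame_disk_not_isolated D C p : tame_disk D C -> D p -> ~ C p ->
  ~ \forall x \near p^', ~ D x.
Proof.
move=> tD Dp Cp pD; apply: (Cp).
have cD : connected D.
  by rewrite -[D]setD0; exact: tame_disk_connected tD (finite_set0 _).
have Dp1 : [set p] = D.
  apply: cD.
  - by exists p.
  - move: pD; rewrite /dnbhs /within /= nearE nbhsE => -[U [oU Up] UD].
    exists U => //; apply/seteqP; split=> [q -> //|q [Dq Uq]].
    by apply: contrapT => /eqP qp; exact: (UD q Uq qp Dq).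
  - exists [set p]; first exact: closed_finite_sphere (finite_set1 _).
    by apply/seteqP; split=> [q ->|q []].
have [c Cc] := tame_circle_neq0 tD.
by have := tame_circle_sub tD Cc; rewrite -Dp1 => <-.
Qed.

(** The disks are collapsed one after the other, the role of [A] being played by the remaining disks
    and the points already obtained. Each point lies in its own disk, so the three are distinct. *)
Lemma homeomorphic_thrice_punctured D1 C1 D2 C2 D3 C3 :
  tame_disk D1 C1 -> tame_disk D2 C2 -> tame_disk D3 C3 ->
  D1 `&` D2 = set0 -> D1 `&` D3 = set0 -> D2 `&` D3 = set0 ->
  exists E : set (sphere R), E #= `I_3 /\
    homeomorphic (set_type (~` (D1 `|` D2 `|` D3))) (set_type (~` E)).
Proof.
move=> t1 t2 t3 d12 d13 d23.
have c1 (p : sphere R) : closed [set p].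
  exact: closed_finite_sphere (finite_set1 _).
have [||p1 D1p1 h1] := @tame_disk_collapse _ D1 C1 (D2 `|` D3) t1.
- by apply: closedU; [exact: tame_disk_closed t2|exact: tame_disk_closed t3].
- by rewrite setIUr d12 d13 setU0.
have [||p2 D2p2 h2] := @tame_disk_collapse _ D2 C2 ([set p1] `|` D3) t2.
- by apply: closedU; [exact: c1|exact: tame_disk_closed t3].
- rewrite setIUr d23 setU0; apply/seteqP; split=> // q [D2p1 qp].
  rewrite qp in D2p1.
  by have : (D1 `&` D2) p1 by []; rewrite d12.
have [||p3 D3p3 h3] := @tame_disk_collapse _ D3 C3 ([set p1] `|` [set p2]) t3.
- by apply: closedU; exact: c1.
- apply/seteqP; split=> // q [D3q [qp|qp]]; rewrite qp in D3q.
    by have : (D1 `&` D3) p1 by []; rewrite d13.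
  by have : (D2 `&` D3) p2 by []; rewrite d23.
exists ([set p3] `|` ([set p1] `|` [set p2])); split; last first.
  rewrite -setUA; apply: homeomorphic_trans h1 _.
  rewrite setUCA; apply: homeomorphic_trans h2 _.
  by rewrite setUCA setUA setUC in h3 *.
have n12 : p1 != p2.
  by apply/eqP => e; suff : set0 p1 by []; rewrite -d12; split=> //; rewrite e.
have n13 : p1 != p3.
  by apply/eqP => e; suff : set0 p1 by []; rewrite -d13; split=> //; rewrite e.
have n23 : p2 != p3.
  by apply/eqP => e; suff : set0 p2 by []; rewrite -d23; split=> //; rewrite e.
have -> : [set p3] `|` ([set p1] `|` [set p2]) = [set` [:: p3; p1; p2]].
  apply/seteqP; split=> q; rewrite /= !inE.
    by move=> [->|[->|->]]; rewrite eqxx ?orbT.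
  by move=> /or3P[] /eqP ->; [left|right; left|right; right].
apply: (@card_seq _ [:: p3; p1; p2]).
by rewrite /= !inE negb_or eq_sym n13 (eq_sym p3) n23 n12.
Qed.

(** The pants are the complement of the three disks, and the components of the rest of the surface
    are the disks with the points of [Q] removed. *)
Lemma pants_of_tame_disks Q D1 C1 D2 C2 D3 C3 (k1 k2 k3 : nat) :
  tame_disk D1 C1 -> tame_disk D2 C2 -> tame_disk D3 C3 ->
  D1 `&` D2 = set0 -> D1 `&` D3 = set0 -> D2 `&` D3 = set0 ->
  finite_set Q -> Q `<=` D1 `|` D2 `|` D3 ->
  Q `&` C1 = set0 -> Q `&` C2 = set0 -> Q `&` C3 = set0 ->
  Q `&` D1 #= `I_k1 -> Q `&` D2 #= `I_k2 -> Q `&` D3 #= `I_k3 ->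
  bound_pants_of_type Q C1 C2 C3 k1 k2 k3.
Proof.
move=> t1 t2 t3 d12 d13 d23 fQ QD q1 q2 q3 n1 n2 n3.
have [cD1 cD2 cD3] := And3 (tame_disk_closed t1) (tame_disk_closed t2)
  (tame_disk_closed t3).
set P := ~` (D1 `|` D2 `|` D3).
have AE : punctured_sphere Q `\` P = (D1 `|` D2 `|` D3) `\` Q.
  by rewrite /P /punctured_sphere setDE setCK setIC -setDE.
(* A point of [Q] inside [D] has a neighbourhood in [D] free of other points of [Q]. A point of [Q]
   in another disk is not isolated in that disk, so no punctured neighbourhood of it lies in [D]. *)
have punct D C D' C' D'' C'' : tame_disk D C -> tame_disk D' C' ->
    tame_disk D'' C'' -> Q `<=` D `|` D' `|` D'' ->
    D `&` D' = set0 -> D `&` D'' = set0 ->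
    Q `&` C = set0 -> Q `&` C' = set0 -> Q `&` C'' = set0 ->
    punctures Q (D `\` Q) = Q `&` D.
  move=> t t' t'' QDs e e' n n' n''; apply/seteqP; split=> q [Qq].
    move=> nq; split=> //.
    have notin B (q' : sphere R) : Q `&` B = set0 -> Q q' -> ~ B q'.
      by move=> QB Qq' Bq'; have : (Q `&` B) q' by []; rewrite QB.
    have [[//|D'q]|D''q] := QDs q Qq.
      exfalso; apply: (tame_disk_not_isolated t' D'q (notin _ _ n' Qq)).
      apply: filterS nq => x [Dx _] D'x.
      by have : (D `&` D') x by []; rewrite e.
    exfalso; apply: (tame_disk_not_isolated t'' D''q (notin _ _ n'' Qq)).
    apply: filterS nq => x [Dx _] D''x.
    by have : (D `&` D'') x by []; rewrite e'.
  move=> Dq; split=> //.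
  have Cq : ~ C q by move=> Cq; have : (Q `&` C) q by []; rewrite n.
  have h1 := tame_disk_nbhs t Dq Cq.
  have h2 : nbhs q (~` (Q `\ q)).
    apply: open_nbhs_nbhs; split; last by move=> -[_]; apply.
    apply: closed_openC; apply: closed_finite_sphere.
    by apply: sub_finite_set fQ; exact: subDsetl.
  rewrite /dnbhs /within /= nearE; apply: filterS (filterI h1 h2).
  move=> x [Dx nQx] xq; split=> // Qx; apply: nQx; split=> //.
  exact/eqP.
exists P; split.
- split; first by move=> p Pp Qp; exact: Pp (QD _ Qp).
  exact: homeomorphic_thrice_punctured t1 t2 t3 d12 d13 d23.
- rewrite /boundary AE.
  (* A point of a circle is a limit of the complement of its disk; near it the other two disks are
     absent, so it is a limit of [P]. *)
  have limP D C D' D'' p : tame_disk D C -> closed D' -> closed D'' ->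
      D `&` D' = set0 -> D `&` D'' = set0 -> Q `&` C = set0 ->
      (D `|` D' `|` D'') = D1 `|` D2 `|` D3 -> C p ->
      (punctured_sphere Q `&` (closure P `&`
        closure ((D1 `|` D2 `|` D3) `\` Q))) p.
    move=> t cD' cD'' e e' n DE Cp.
    have Dp := tame_circle_sub t Cp.
    have nQ : ~ Q p by move=> Qp; have : (Q `&` C) p by []; rewrite n.
    split=> //; split; last first.
      by apply: subset_closure; split=> //; rewrite -DE; left; left.
    rewrite /P -DE => U Up.
    have : nbhs p (~` (D' `|` D'')).
      apply: open_nbhs_nbhs; split.
        by apply: closed_openC; exact: closedU.
      move=> -[D'p|D''p].
        by have : (D `&` D') p by []; rewrite e.
      by have : (D `&` D'') p by []; rewrite e'.
    move=> /(filterI Up)/(tame_circle_limit t Cp)[x [nDx [Ux nx]]].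
    by exists x; split=> // -[[//|D'x]|D''x]; apply: nx; [left|right].
  apply/seteqP; split=> [p [nQ [cP cA]]|p].
    (* Off its circle a disk is a neighbourhood of its points, which are therefore not limits of
       [P]. *)
    have inC D C : tame_disk D C -> D `<=` D1 `|` D2 `|` D3 -> D p -> C p.
      move=> t DD Dp; apply: contrapT => Cp.
      have /cP[x [Px Dx]] := tame_disk_nbhs t Dp Cp.
      by apply: Px; exact: DD.
    have /closure_id cU : closed (D1 `|` D2 `|` D3).
      by apply: closedU => //; exact: closedU.
    have : (D1 `|` D2 `|` D3) p.
      by rewrite cU; apply: closure_subset cA => x [].
    move=> [[Dp|Dp]|Dp].
    + by left; left; apply: (inC _ _ t1) => // x; left; left.
    + by left; right; apply: (inC _ _ t2) => // x; left; right.
    + by right; apply: (inC _ _ t3) => // x; right.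
  move=> [[Cp|Cp]|Cp].
  + exact: (limP D1 C1 D2 D3).
  + apply: (limP D2 C2 D1 D3) => //; first by rewrite setIC.
    by rewrite (setUC D2).
  + apply: (limP D3 C3 D1 D2) => //; [by rewrite setIC|by rewrite setIC|].
    by rewrite -setUA setUC.
- have piece D C F : tame_disk D C -> closed F -> D `&` F = set0 ->
      D `|` F = D1 `|` D2 `|` D3 -> forall x, (D `\` Q) x ->
      connected_component ((D1 `|` D2 `|` D3) `\` Q) x = D `\` Q.
    move=> t cF DF DE x [Dx Qx].
    have AD : ((D `|` F) `\` Q) `&` D = D `\` Q.
      apply/seteqP; split=> [y [[_ Qy] Dy]|y [Dy Qy]]; first by split.
      by split=> //; split=> //; left.
    rewrite -DE (@connected_component_piece _ _ D F)// ?AD//.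
    + exact: tame_disk_closed t.
    + exact: tame_disk_connected t fQ.
    + by split=> //; left.
  have ne D C : tame_disk D C -> Q `&` C = set0 -> (D `\` Q) !=set0.
    move=> t n; have [c Cc] := tame_circle_neq0 t; exists c; split.
      exact: tame_circle_sub t _ Cc.
    by move=> Qc; have : (Q `&` C) c by []; rewrite n.
  have neq D C D' : tame_disk D C -> Q `&` C = set0 -> D `&` D' = set0 ->
      D `\` Q <> D' `\` Q.
    move=> t n DD e; have [x Dx] := ne _ _ t n.
    have D'x : (D' `\` Q) x by rewrite -e.
    by suff : set0 x by []; rewrite -DD; split; [case: Dx|case: D'x].
  exists (D1 `\` Q), (D2 `\` Q), (D3 `\` Q); split.
  + rewrite AE.
    have p1 := piece D1 C1 (D2 `|` D3) t1 (closedU cD2 cD3).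
    have {}p1 := p1 (ltac:(by rewrite setIUr d12 d13 setU0)) (setUA _ _ _).
    have p2 := piece D2 C2 (D1 `|` D3) t2 (closedU cD1 cD3).
    have {}p2 := p2 (ltac:(by rewrite setIUr setIC d12 d23 setU0)).
    have {}p2 := p2 (ltac:(by rewrite setUCA setUA)).
    have p3 := piece D3 C3 (D1 `|` D2) t3 (closedU cD1 cD2).
    have {}p3 := p3 (ltac:(by rewrite setIC setIUl d13 d23 setU0)) (setUC _ _).
    apply/seteqP; split=> [_ [x [[[Dx|Dx]|Dx] Qx] <-]|B].
    * by rewrite p1//; left; left.
    * by rewrite p2//; left; right.
    * by rewrite p3//; right.
    move=> [[->|->]|->].
    * have [x [Dx Qx]] := ne _ _ t1 q1; exists x; last by rewrite p1.
      by split=> //; left; left.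
    * have [x [Dx Qx]] := ne _ _ t2 q2; exists x; last by rewrite p2.
      by split=> //; left; right.
    * have [x [Dx Qx]] := ne _ _ t3 q3; exists x; last by rewrite p3.
      by split=> //; right.
  + by split; [exact: neq t1 q1 d12|exact: neq t1 q1 d13|exact: neq t2 q2 d23].
  + split.
    * by rewrite (punct D1 C1 D2 C2 D3 C3).
    * rewrite (punct D2 C2 D1 C1 D3 C3)// 1?setIC//.
      by rewrite (setUC D2).
    * rewrite (punct D3 C3 D1 C1 D2 C2)// 1?[D3 `&` _]setIC//.
      by rewrite -setUA setUC.
Qed.

End Pants.

(** * Disks around intervals of punctures *)

Section Positions.
Variable R : realType.

Lemma pos_lower_bound (n : nat) (a : nat -> R) :
  (forall i, (i < n)%N -> 0 < a i) ->
  exists2 g, 0 < g & forall i, (i < n)%N -> g <= a i.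
Proof.
elim: n => [|n IH] a0; first by exists 1.
have [i /ltnW|g g0 ga] := IH; first exact: a0.
exists (Num.min g (a n)); first by rewrite lt_min g0 a0.
move=> i; rewrite ltnS leq_eqVlt => /predU1P[->|/ga ia].
  by rewrite ge_min lexx orbT.
by rewrite ge_min ia.
Qed.

(* The six free positions between consecutive values leave room for pairwise
   disjoint curves with the same cuts. *)
Lemma exists_positions (n : nat) (e : nat -> R) :
  (forall i j, (i < j < n)%N -> e i < e j) ->
  exists (T : nat -> R) (d : R), [/\ 0 < d,
    forall j k, (j < k)%N -> T j + d <= T k &
    forall i, (i < n)%N -> T (7 * i + 6)%N = e i].
Proof.
move=> einc.
have [i ni|g0 g00 g0P] := @pos_lower_bound n.-1 (fun i => e i.+1 - e i).
  by rewrite subr_gt0; apply: einc; lia.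
pose g := Num.min g0 1.
have gP i : (i < n.-1)%N -> e i + g <= e i.+1.
  move=> /g0P /= h; have gg0 : g <= g0 by rewrite ge_min lexx.
  lra.
have g1 : g <= 1 by rewrite ge_min lexx orbT.
have gp : 0 < g by rewrite lt_min g00 ltr01.
(* The values are continued by unit steps after the last one, which is why [g] is capped at 1. *)
pose e' i := e (minn i n.-1) + (i - n.-1)%:R.
have e'P i : e' i + g <= e' i.+1.
  rewrite /e'; have [ni|ni] := ltnP i n.-1.
    rewrite (minn_idPl ni).
    have -> : (i - n.-1)%N = 0%N by lia.
    have -> : (i.+1 - n.-1)%N = 0%N by lia.
    by rewrite !addr0 gP.
  rewrite (minn_idPr (leqW ni)) subSn// -natr1; lra.
pose d := g / 7.
(* Each value is preceded by six positions at distance [d]; since [d = g / 7], a gap of [d] also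
   remains after the previous value. *)
pose T k := e' (k %/ 7)%N - (6 - k %% 7)%:R * d.
have dp : 0 < d by rewrite divr_gt0.
have TS k : T k + d <= T k.+1.
  rewrite /T; have [b6|b6] := ltnP (k %% 7)%N 6.
    rewrite (_ : (k.+1 %/ 7)%N = (k %/ 7)%N); last by lia.
    rewrite (_ : (6 - k %% 7)%N = (6 - k.+1 %% 7).+1); last by lia.
    by rewrite -natr1; lra.
  rewrite (_ : (k.+1 %/ 7)%N = (k %/ 7).+1); last by lia.
  rewrite (_ : (k %% 7)%N = 6%N); last by lia.
  rewrite (_ : (k.+1 %% 7)%N = 0%N); last by lia.
  have := e'P (k %/ 7)%N; rewrite (_ : g = 7 * d); last by rewrite /d; field.
  by rewrite subnn subn0; lra.
exists T, d; split=> //.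
- move=> j; elim=> // k IH; rewrite ltnS leq_eqVlt => /predU1P[->|/IH jk] //.
  by have := TS k; lra.
- move=> i ni; rewrite /T (_ : ((7 * i + 6) %/ 7)%N = i); last by lia.
  rewrite (_ : ((7 * i + 6) %% 7)%N = 6%N); last by lia.
  rewrite subnn mul0r subr0 /e' (minn_idPl _); last by lia.
  by rewrite (_ : (i - n.-1)%N = 0%N) ?addr0//; lia.
Qed.

(** * Homogeneous piecewise linear homeomorphisms *)

Local Notation vec := 'rV[R]_3.

Ltac cont_row3 := let v := fresh in move=> v;
  have [? ? ?] := And3 (@continuous_cx R v) (@continuous_cy R v)
    (@continuous_cz R v);
  apply: continuous_row3; rewrite /moment; solve_continuous.

(** A linear map of determinant [t - s]. *)
Lemma homeo_moments (s t : R) : s != t ->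
  homogeneous_homeo (fun v => row3 (moment s v) (moment t v) (cz v)).
Proof.
move=> st; have st0 : s - t != 0 by rewrite subr_eq0.
exists (fun v => row3
  (cx v - s ^+ 2 * cz v
     - s * ((cx v - s ^+ 2 * cz v - (cy v - t ^+ 2 * cz v)) * (s - t)^-1))
  ((cx v - s ^+ 2 * cz v - (cy v - t ^+ 2 * cz v)) * (s - t)^-1)
  (cz v)); split.
- by cont_row3.
- by cont_row3.
- by move=> a v _; apply: vec_eq; rewrite /moment !cE; ring.
- by move=> v; apply: vec_eq; rewrite /moment !cE //; field.
- by move=> v; apply: vec_eq; rewrite /moment !cE //; field.
Qed.

Lemma homeo_fold (K : R) :
  homogeneous_homeo (fun v => row3 (cx v + K * `|cy v|) (cy v) (cz v)).
Proof.
exists (fun v => row3 (cx v - K * `|cy v|) (cy v) (cz v)); split.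
- by cont_row3.
- by cont_row3.
- move=> a v a0; apply: vec_eq; rewrite !cE // normrM gtr0_norm//; ring.
- by move=> v; apply: vec_eq; rewrite !cE //; ring.
- by move=> v; apply: vec_eq; rewrite !cE //; ring.
Qed.

Lemma homeo_shear (m : R) :
  homogeneous_homeo (fun v => row3 (cx v) (cy v - m * cx v) (cz v)).
Proof.
exists (fun v => row3 (cx v) (cy v + m * cx v) (cz v)); split.
- by cont_row3.
- by cont_row3.
- by move=> a v a0; apply: vec_eq; rewrite !cE //; ring.
- by move=> v; apply: vec_eq; rewrite !cE //; ring.
- by move=> v; apply: vec_eq; rewrite !cE //; ring.
Qed.

(** For positive [r] and [eps] the hemisphere is pulled back to the cone [r x >= |y| + eps |z|],
    whose section at [x = 1] is a rhombus. *)
Lemma homeo_pyramid (r eps : R) : r != 0 -> homogeneous_homeo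
  (fun v => row3 (r * cx v - (`|cy v| + eps * `|cz v|)) (cy v) (cz v)).
Proof.
move=> r0; exists (fun v =>
  row3 ((cx v + (`|cy v| + eps * `|cz v|)) * r^-1) (cy v) (cz v)); split.
- by cont_row3.
- by cont_row3.
- by move=> a v a0; apply: vec_eq; rewrite !cE // !normrM gtr0_norm//; ring.
- by move=> v; apply: vec_eq; rewrite !cE //; field.
- by move=> v; apply: vec_eq; rewrite !cE //; field.
Qed.

(** Exchanges the two hemispheres, so that the disk on the other side of a curve is tame too. *)
Lemma homeo_opp_cx :
  homogeneous_homeo (fun v : vec => row3 (- cx v) (cy v) (cz v)).
Proof.
exists (fun v => row3 (- cx v) (cy v) (cz v)); split.
- by cont_row3.
- by cont_row3.
- by move=> a v a0; apply: vec_eq; rewrite !cE //; ring.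
- by move=> v; apply: vec_eq; rewrite !cE //; ring.
- by move=> v; apply: vec_eq; rewrite !cE //; ring.
Qed.

End Positions.

Section IntervalDisks.
Variable R : realType.
Local Notation vec := 'rV[R]_3.

(* The fold [x + K |y|] with [K] large makes [x] positive; it keeps slopes
   distinct because the sign of [y] and the ratio [x / y] can be read off. *)
Lemma exists_slope_chart (l : seq (sphere R)) :
  exists B : vec -> vec, [/\ homogeneous_homeo B,
    forall q, q \in l -> 0 < cx (B (val q)) &
    forall q q', q \in l -> q' \in l ->
      cy (B (val q)) / cx (B (val q)) = cy (B (val q')) / cx (B (val q')) ->
      q = q'].
Proof.
have [t tP] := exists_moment_neq0 [seq val q | q <- l].
have Y0 q : q \in l -> moment t (val q) != 0.
  by move=> ql; apply: tP; [exact: map_f|exact: sphere_neq0].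
(* Normalized to have moment 1 at [t], so the moment of [u q] at [s] is the ratio [X q / Y q] below.
   A generic [s] separates these ratios whenever the vectors [u q] differ; the extra vector
   [(- t, 1, 0)], of moment [s - t], ensures [s != t]. *)
pose u (q : sphere R) := (moment t (val q))^-1 *: val q.
have [s sP] := exists_moment_neq0
  (row3 (- t) 1 0 :: [seq u q - u q' | q <- l, q' <- l]).
have st : s != t.
  have := sP (row3 (- t) 1 0); rewrite inE eqxx => /(_ isT).
  have nz : row3 (- t) 1 0 != 0 :> vec.
    by apply/eqP => /(congr1 (@cy R)); rewrite !cE => /eqP; rewrite oner_eq0.
  move=> /(_ nz); rewrite /moment !cE mulr1 mulr0 addr0 addrC subr_eq0.
  by [].
pose X (q : sphere R) := moment s (val q).
pose Y (q : sphere R) := moment t (val q).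
(* With [k] below all [|Y| / (|X| + 1)], the constant [K = 1 / k] gives [K |Y| >= |X| + 1 > - X]. *)
have [|k k0 kP] := @pos_lower_bound R (size l)
  (fun i => `|Y (nth (radial (e1 R)) l i)| /
            (`|X (nth (radial (e1 R)) l i)| + 1)).
  move=> i il; apply: divr_gt0; first by rewrite normr_gt0 Y0// mem_nth.
  by rewrite ltr_wpDl.
pose K := k^-1.
have XK q : q \in l -> 0 < X q + K * `|Y q|.
  move=> ql; have il : (index q l < size l)%N by rewrite index_mem.
  have X1 : 0 < `|X q| + 1 by rewrite ltr_wpDl.
  have := kP _ il; rewrite nth_index// ler_pdivlMr// => h.
  have : `|X q| + 1 <= K * `|Y q|.
    by rewrite /K mulrC ler_pdivlMr// mulrC.
  have := ler_norm (- X q); rewrite normrN; lra.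
exists ((fun v => row3 (cx v + K * `|cy v|) (cy v) (cz v)) \o
        (fun v => row3 (moment s v) (moment t v) (cz v))); split.
- by apply: homogeneous_homeo_comp; [exact: homeo_moments|exact: homeo_fold].
- by move=> q ql; rewrite /= !cE; exact: XK.
move=> q q' ql q'l; rewrite /= !cE -/(X q) -/(X q') -/(Y q) -/(Y q') => e.
have [Yq Yq'] : Y q != 0 /\ Y q' != 0 by split; exact: Y0.
have Xq := XK _ ql; have Xq' := XK _ q'l.
have e' : Y q * (X q' + K * `|Y q'|) = Y q' * (X q + K * `|Y q|).
  by move/eqP: e; rewrite eqr_div ?lt0r_neq0// => /eqP.
(* Equal slopes over positive denominators give [Y q] and [Y q'] the same sign, and then the fold
   terms cancel from the equation. *)
have YY : 0 < Y q * Y q'.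
  rewrite -(pmulr_lgt0 _ Xq) -mulrA -e' mulrA.
  by rewrite mulr_gt0// -expr2 exprn_even_gt0.
have eX : Y q * X q' = Y q' * X q.
  have : Y q * `|Y q'| = Y q' * `|Y q|.
    have [y|y] := ltrP 0 (Y q).
      have y' : 0 < Y q' by rewrite -(pmulr_rgt0 _ y).
      by rewrite !gtr0_norm// mulrC.
    have {}y : Y q < 0 by rewrite lt_neqAle Yq.
    have y' : Y q' < 0 by rewrite -(nmulr_rgt0 _ y).
    by rewrite !ltr0_norm//; ring.
  move=> h; move: e'; rewrite !mulrDr => e'.
  have : K * (Y q * `|Y q'|) = K * (Y q' * `|Y q|) by rewrite h.
  lra.
have uu : u q = u q'.
  apply/eqP; rewrite -subr_eq0; apply/negPn/negP => d0.
  have dl : u q - u q' \in row3 (- t) 1 0 :: [seq u q - u q' | q <- l, q' <- l].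
    rewrite inE; apply/orP; right; apply/allpairsP.
    by exists (q, q').
  have := sP _ dl d0; apply/negP/negPn.
  rewrite (_ : moment s _ = X q / Y q - X q' / Y q'); last first.
    by rewrite /u /X [LHS]/moment !cE /moment; ring.
  by rewrite subr_eq0 eqr_div// mulrC -eX mulrC.
have : val q' = (Y q' / Y q) *: val q.
  have := congr1 (fun w => Y q' *: w) uu; rewrite /u !scalerA mulfV//.
  by rewrite scale1r => <-.
(* The factor [Y q' / Y q] is positive, so the points lie on the same ray and are not antipodal. *)
move=> vE; rewrite -[q']radial_val vE radialZ ?radial_val//.
  rewrite -(pmulr_lgt0 _ YY).
  rewrite (_ : Y q' / Y q * (Y q * Y q') = Y q' ^+ 2) ?exprn_even_gt0//.
  by field.
exact: sphere_neq0.
Qed.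

(** Cuts are indexed by positions, the one of puncture [i] being [7 i + 6]. The curve [crv s t]
    bounds two closed disks: [inner s t], around the punctures between the cuts, and [outer s t],
    around the others. *)
Lemma exists_interval_disks (n : nat) (Q : set (sphere R)) : Q #= `I_n ->
  exists (inner outer crv : nat -> nat -> set (sphere R)) (q : nat -> sphere R),
  [/\ Q = q @` `I_n,
      forall i j, (i < n)%N -> (j < n)%N -> q i = q j -> i = j,
      forall s t, (s < t)%N -> tame_disk (inner s t) (crv s t) /\
        tame_disk (outer s t) (crv s t),
      (forall s t s' t', (s < t)%N -> (t < s')%N -> (s' < t')%N ->
        inner s t `&` inner s' t' = set0) /\
      (forall s t s' t', (s < t)%N -> (s' < s)%N -> (t < t')%N ->
        inner s t `&` outer s' t' = set0) &
      forall i s t, (i < n)%N -> (s < t)%N ->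
        ((s < 7 * i + 6 < t)%N -> inner s t (q i) /\ ~ outer s t (q i)) /\
        ((7 * i + 6 < s)%N \/ (t < 7 * i + 6)%N ->
          outer s t (q i) /\ ~ inner s t (q i))].
Proof.
move=> Qn.
have [l [ul Ql sl]] : exists l, [/\ uniq l, Q = [set` l] & size l = n].
  have /finite_seqP[l Ql] : finite_set Q by exists n.
  have QE : Q = [set` undup l].
    by rewrite Ql; apply/seteqP; split=> x; rewrite /= mem_undup.
  exists (undup l); split=> //; first exact: undup_uniq.
  apply/(@card_eq_II _ _); apply: card_eq_trans Qn.
  by rewrite card_eq_sym QE; apply: card_seq; exact: undup_uniq.
have [B [hB B0 Binj]] := exists_slope_chart l.
pose eta (p : sphere R) := cy (B (val p)) / cx (B (val p)).
pose l' := sort (fun p p' => eta p <= eta p') l.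
have ml p : (p \in l') = (p \in l) by rewrite mem_sort.
have sl' : size l' = n by rewrite size_sort.
pose q := nth (radial (e1 R)) l'.
have ql i : (i < n)%N -> q i \in l.
  by move=> ni; rewrite -ml mem_nth// sl'.
have einc i j : (i < j < n)%N -> eta (q i) < eta (q j).
  move=> /andP[ij jn]; rewrite lt_neqAle; apply/andP; split.
    apply/eqP => /Binj; rewrite !ql// ?(ltn_trans ij)// => /(_ isT isT) /eqP.
    by rewrite nth_uniq ?sl' ?sort_uniq ?(ltn_trans ij)// (ltn_eqF ij).
  apply: (@sorted_leq_nth _ (fun p p' => eta p <= eta p')) => //.
  - by move=> a b c; exact: le_trans.
  - by apply: sort_sorted => a b; exact: le_total.
  - by rewrite inE sl' (ltn_trans ij).
  - by rewrite inE sl'.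
  - exact: ltnW.
have [T [d [d0 Tinc Te]]] := exists_positions einc.
(* So small that at every puncture [eps |z|] is less than [d x], where [d] is the least gap between
   positions. *)
have [i ni|eps eps0 epsP] := @pos_lower_bound R n
  (fun i => d * cx (B (val (q i))) / (2 * (`|cz (B (val (q i)))| + 1))).
  by rewrite divr_gt0 ?mulr_gt0 ?B0 ?ql// ltr_wpDl.
have zP i : (i < n)%N -> eps * `|cz (B (val (q i)))| < d * cx (B (val (q i))).
  move=> ni; have := epsP i ni.
  have z1 : 0 < 2 * (`|cz (B (val (q i)))| + 1) by rewrite mulr_gt0// ltr_wpDl.
  have := mulr_ge0 (ltW eps0) (normr_ge0 (cz (B (val (q i))))).
  by rewrite ler_pdivlMr// => ? ?; lra.
pose Phi s t v := let m := (T s + T t) / 2 in let r := (T t - T s) / 2 in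
  r * cx (B v) - (`|cy (B v) - m * cx (B v)| + eps * `|cz (B v)|).
have hPhi s t : (s < t)%N -> exists F, homogeneous_homeo F /\
    forall v, cx (F v) = Phi s t v.
  move=> st; have := Tinc _ _ st => Tst.
  exists ((fun v => row3 ((T t - T s) / 2 * cx v
              - (`|cy v| + eps * `|cz v|)) (cy v) (cz v)) \o
          ((fun v => row3 (cx v) (cy v - (T s + T t) / 2 * cx v) (cz v)) \o B)).
  split; last by move=> v; rewrite /= !cE.
  apply: homogeneous_homeo_comp; last first.
    by apply: homeo_pyramid; apply: lt0r_neq0; lra.
  by apply: homogeneous_homeo_comp => //; exact: homeo_shear.
pose inner s t := [set p : sphere R | 0 <= Phi s t (val p)].
pose outer s t := [set p : sphere R | Phi s t (val p) <= 0].
pose crv s t := [set p : sphere R | Phi s t (val p) = 0].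
have inner_x s t p : (s < t)%N -> inner s t p ->
    [/\ 0 < cx (B (val p)), T s * cx (B (val p)) <= cy (B (val p))
      & cy (B (val p)) <= T t * cx (B (val p))].
  move=> st; have := Tinc _ _ st => Tst; rewrite /inner /Phi /= => H.
  have n1 := normr_ge0 (cy (B (val p)) - (T s + T t) / 2 * cx (B (val p))).
  have n2 := mulr_ge0 (ltW eps0) (normr_ge0 (cz (B (val p)))).
  have x0 : 0 <= cx (B (val p)).
    have : 0 <= (T t - T s) / 2 * cx (B (val p)) by lra.
    by rewrite pmulr_rge0//; lra.
  move: H; set x := cx _; set y := cy _; set z := cz _.
  move=> H; have /ler_normlP[a1 a2] :
    `|y - (T s + T t) / 2 * x| <= (T t - T s) / 2 * x by lra.
  split; [|lra|lra].
  (* If [x] vanished, the defining inequality would force [y = z = 0]. *)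
  rewrite lt_def x0 andbT; apply/eqP => xe.
  have /eqP := homogeneous_homeo_neq0 hB (sphere_neq0 p); apply.
  have z0 : eps * `|z| = 0 by move: H n1 n2; rewrite -/x -/y -/z xe; lra.
  have ze : z = 0.
    by move/eqP: z0; rewrite mulf_eq0 (gt_eqF eps0) normr_eq0 => /eqP.
  by apply: vec_eq; rewrite !cE// -/y; move: a1 a2; rewrite xe; lra.
exists inner, outer, crv, q; split.
- rewrite Ql; apply/seteqP; split=> [p /= pl|_ [i /= ni <-]]; last exact: ql.
  rewrite -ml in pl; exists (index p l'); last exact: nth_index.
  by rewrite /= -sl' index_mem.
- move=> i j ni nj /eqP; rewrite nth_uniq ?sl' ?sort_uniq//.
  by move/eqP.
- move=> s t /hPhi[F [hF FE]]; split.
    have := homogeneous_tame_disk hF.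
    by congr tame_disk; apply/seteqP; split=> p; rewrite /mkset FE.
  have := homogeneous_tame_disk (homogeneous_homeo_comp hF (@homeo_opp_cx R)).
  congr tame_disk; apply/seteqP; split=> p; rewrite /mkset /= cE FE ?oppr_ge0//.
    by move/eqP; rewrite oppr_eq0 => /eqP.
  by rewrite /crv /= => ->; rewrite oppr0.
- split=> s t s' t'.
    move=> st ts' s't'; apply/seteqP; split=> // p [i1 i2].
    have [x0 _ y1] := inner_x _ _ _ st i1.
    have [_ y2 _] := inner_x _ _ _ s't' i2.
    have := Tinc _ _ ts' => h.
    have : T t * cx (B (val p)) < T s' * cx (B (val p)).
      by rewrite ltr_pM2r//; lra.
    by move=> ?; suff : (0 : R) < 0; [rewrite ltxx|lra].
  move=> st s's tt'; apply/seteqP; split=> // p [i1 i2].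
  have [x0 _ _] := inner_x _ _ _ st i1.
  have hs := Tinc _ _ s's; have ht := Tinc _ _ tt'.
  have hsx : T s' * cx (B (val p)) < T s * cx (B (val p)).
    by rewrite ltr_pM2r//; lra.
  have htx : T t * cx (B (val p)) < T t' * cx (B (val p)).
    by rewrite ltr_pM2r//; lra.
  move: i1 i2; rewrite /inner /outer /Phi /=.
  set x := cx _ in hsx htx *; set y := cy _; set e := eps * _ => i1 i2.
  suff : (0 : R) < 0 by rewrite ltxx.
  (* The term [eps |z|] is the same for both curves, so strict nesting of the slope intervals gives
     strict nesting of the disks. *)
  have : `|y - (T s' + T t') / 2 * x| < (T t' - T s') / 2 * x - e.
    have /ler_normlP[a1 a2] :
      `|y - (T s + T t) / 2 * x| <= (T t - T s) / 2 * x - e by lra.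
    by rewrite ltr_norml; apply/andP; split; lra.
  lra.
- move=> i s t ni st.
  have x0 := B0 _ (ql i ni); have zi := zP i ni.
  have yi : cy (B (val (q i))) = T (7 * i + 6)%N * cx (B (val (q i))).
    by rewrite Te// /eta divfK// lt0r_neq0.
  have gap j k : (j < k)%N ->
      T j * cx (B (val (q i))) + d * cx (B (val (q i))) <=
      T k * cx (B (val (q i))).
    by move=> jk; rewrite -mulrDl ler_pM2r// Tinc.
  rewrite /inner /outer /Phi /= yi.
  set x := cx _ in x0 zi yi gap *; set e := eps * _ in zi *.
  set p := T (7 * i + 6)%N.
  split.
    move=> /andP[/gap g1 /gap g2].
    have : `|p * x - (T s + T t) / 2 * x| < (T t - T s) / 2 * x - e.
      by rewrite ltr_norml; apply/andP; split; rewrite -/p in g1 g2; lra.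
    by move=> h; split; [lra|apply/negP; rewrite -ltNge; lra].
  move=> ps.
  (* Outside the interval the slope is at least [d] beyond its half-length away from the
     midpoint. *)
  have : (T t - T s) / 2 * x + d * x <= `|p * x - (T s + T t) / 2 * x|.
    case: ps => /gap; rewrite -/p => g1.
      have := ler_norm (- (p * x - (T s + T t) / 2 * x)); rewrite normrN; lra.
    have := ler_norm (p * x - (T s + T t) / 2 * x); lra.
  have e0 : 0 <= e by rewrite /e mulr_ge0// ltW.
  have dx : 0 < d * x by rewrite mulr_gt0.
  by move=> h; split; [lra|apply/negP; rewrite -ltNge; lra].
Qed.

End IntervalDisks.

(** * Choice of the cuts *)

Definition cbrt (x : nat) : nat := \max_(k < x.+1 | (k ^ 3 <= x)%N) k.

Lemma cbrt_le x : (cbrt x ^ 3 <= x)%N.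
Proof.
rewrite /cbrt; elim/big_ind: _ => // a b; rewrite /maxn; case: ifP => //.
Qed.

Lemma cbrt_gt x : (x < (cbrt x).+1 ^ 3)%N.
Proof.
rewrite ltnNge; apply/negP => h.
have hx : ((cbrt x).+1 < x.+1)%N.
  rewrite ltnS; apply: leq_trans h.
  by rewrite -{1}(expn1 _.+1) leq_pexp2l.
have := @leq_bigmax_cond 'I_x.+1 [pred k : 'I_x.+1 | (k ^ 3 <= x)%N]
  (fun k => nat_of_ord k) (Ordinal hx) h.
by rewrite /= -/(cbrt x) ltnn.
Qed.

(** With [b] a power of the base [m], adding [b z] clears the digit of weight [b] and keeps the
    lower ones; [z] is the opposite of that digit modulo [m]. *)
Lemma digit_shift (b m y : nat) : (0 < b)%N -> (0 < m)%N ->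
  exists z h, (z < m)%N /\ (y + b * z = y %% b + b * m * h)%N.
Proof.
move=> b0 m0; have [z [zm /dvdnP[h hE]]] :
    exists z, (z < m)%N /\ (m %| y %/ b + z)%N.
  exists ((m - (y %/ b) %% m) %% m)%N; split; first by rewrite ltn_mod.
  rewrite /dvdn modnDmr -modnDml subnKC ?modnn//.
  by rewrite ltnW// ltn_mod.
exists z, h; split=> //.
by rewrite {1}(divn_eq y b) -mulnA -(mulnC h) -hE; lia.
Qed.

Section Codes.
Variable n : nat.

(** The successor makes [side] positive, and [u < side^3] still gives [u <= n %/ 3], which is at
    most the largest gap. *)
Definition side : nat := cbrt (n %/ 3).+1.
Local Notation c := side.

(** The ranges with 25 suffice because the cuts are at most [n < 24 c^3]. *)
Definition cuts1 := [seq (c * a)%N | a <- iota 0 (c ^ 2)].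
Definition cuts2 :=
  [seq (a + c ^ 2 * b)%N | a <- iota 0 c, b <- iota 0 (25 * c)].
Definition cuts3 :=
  [seq (a + c ^ 3 * b)%N | a <- iota 0 (c ^ 2), b <- iota 0 25].

(** A cut [u] lies between the punctures at [7 u - 1] and [7 u + 6]. The offsets 0 to 5 are ordered
    so that the three disks stay disjoint when cuts coincide, that is, when a gap is 0. *)
Definition codes : seq (nat * nat) :=
  [seq (7 * u + 1, 7 * v + 2)%N | u <- cuts1, v <- cuts2] ++
  [seq (7 * v + 3, 7 * w + 4)%N | v <- cuts2, w <- cuts3] ++
  [seq (7 * u, 7 * w + 5)%N | u <- cuts1, w <- cuts3].

(** The three kinds of curves contribute 25, 625 and 25 times [c^4]. *)
Lemma size_codes : size codes = (675 * c ^ 4)%N.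
Proof.
rewrite !size_cat !size_allpairs !size_map !size_iota.
rewrite !expnS expn0; nia.
Qed.

Lemma codes_neq6 s t : (s, t) \in codes -> (s %% 7 != 6)%N && (t %% 7 != 6)%N.
Proof.
by rewrite !mem_cat => /or3P[] /allpairsP[[u v] /= [_ _ [-> ->]]];
  apply/andP; split; apply/eqP; lia.
Qed.

(* Base [c] digits of the shift are chosen one at a time: the first cut has
   digit [0] equal to zero, the second one digit [1], the third one digit [2]. *)
Lemma exists_cuts k1 k2 k3 : (k1 <= k2 <= k3)%N -> (k1 + k2 + k3 = n)%N ->
  exists u, [/\ u \in cuts1, (u + k1)%N \in cuts2, (u + k1 + k2)%N \in cuts3
    & (u + k1 + k2 <= n)%N].
Proof.
move=> /andP[k12 k23] kn.
have c3 : (c ^ 3 <= (n %/ 3).+1)%N by exact: cbrt_le.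
have n3 : ((n %/ 3).+1 < c.+1 ^ 3)%N by exact: cbrt_gt.
have c0 : (0 < c)%N by case: (c) n3 => //; lia.
have n24 : (n < 24 * c ^ 3)%N.
  have : (c.+1 ^ 3 <= 8 * c ^ 3)%N.
    rewrite (_ : 8 = 2 ^ 3)%N// -expnMn leq_exp2r//; lia.
  lia.
have cc0 : (0 < c ^ 2)%N by rewrite expn_gt0 c0.
(* First [x1] clears digit 1 of the second cut, then [x2] clears digit 2 of the third. *)
have [x1 [h1 [x1c e1]]] := @digit_shift c c k1 c0 c0.
have [x2 [h2 [x2c e2]]] := @digit_shift (c ^ 2) c (k1 + c * x1 + k2) cc0 c0.
have a1 : (k1 %% c < c)%N by rewrite ltn_mod.
have a2 : ((k1 + c * x1 + k2) %% c ^ 2 < c ^ 2)%N by rewrite ltn_mod.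
rewrite -expnSr in e2.
have cE : (c * c = c ^ 2)%N by rewrite expnS expn1.
have ccE : (c ^ 2 * c = c ^ 3)%N by rewrite -expnSr.
rewrite cE in e1.
set r2 := (_ %% c ^ 2)%N in e2 a2; set r1 := (_ %% c)%N in e1 a1.
have xlt : (x1 + c * x2 < c ^ 2)%N.
  have : (c * x2 + c <= c * c)%N by rewrite -mulnSr leq_mul2l x2c orbT.
  lia.
have uE : (c * (x1 + c * x2) = c * x1 + c ^ 2 * x2)%N.
  by rewrite mulnDr mulnA cE.
have ult : (c * (x1 + c * x2) < c ^ 3)%N.
  by rewrite -ccE (mulnC (c ^ 2)%N) ltn_pmul2l.
have wn : (c * (x1 + c * x2) + k1 + k2 <= n)%N by lia.
exists (c * (x1 + c * x2))%N; split=> //.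
- by apply: map_f; rewrite mem_iota.
(* The later shift by [c^2 x2] does not disturb the digits 0 and 1 of the second cut. *)
- apply/allpairsP; exists (r1, (h1 + x2)%N); rewrite !mem_iota /=; split=> //.
    rewrite add0n -(ltn_pmul2l cc0) mulnDr.
    have : (c ^ 2 * (25 * c) = 25 * c ^ 3)%N by rewrite mulnCA ccE.
    lia.
  by rewrite uE mulnDr; lia.
- apply/allpairsP; exists (r2, h2); rewrite !mem_iota /=; split=> //.
    have c30 : (0 < c ^ 3)%N by rewrite expn_gt0 c0.
    by rewrite -(ltn_pmul2l c30); lia.
  by rewrite uE; lia.
Qed.

End Codes.

(** * Size of the family *)

(** From [side^3 <= n] follows [side^4 <= n^(4/3)]; for [n >= 2] the logarithmic factor is at least
    its value at 2, which goes into the constant. *)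
Lemma codes_size_bigO (R : realType) :
  (fun n : nat => (675 * side n ^ 4)%N%:R : R^o) =O_\oo
    (fun n : nat => n%:R `^ (4 / 3) * ln n%:R `^ (2 / 3) : R^o).
Proof.
apply/eqO_exP.
have l2 : 0 < (ln 2 : R) `^ (2 / 3) by rewrite powR_gt0// ln_gt0// ltr1n.
have C0 : 0 < 675%:R :> R by rewrite ltr0n.
exists (675%:R / (ln 2 : R) `^ (2 / 3)).
  by apply: divr_gt0; [exact: C0|exact: l2].
near=> n.
have n2 : (2 <= n)%N by near: n; exists 2%N.
have n2R : 2 <= n%:R :> R by rewrite ler_nat.
rewrite [leLHS]ger0_norm ?ler0n// [`|_ * _|]ger0_norm ?mulr_ge0 ?powR_ge0//.
have h : (side n)%:R ^+ 4 <= (n%:R : R) `^ (4 / 3).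
  have -> : ((side n)%:R ^+ 4 : R) = ((side n)%:R ^+ 3) `^ (4 / 3).
    rewrite -powR_mulrn ?ler0n// -[in RHS]powR_mulrn ?ler0n// -powRrM.
    by congr (_ `^ _); field.
  have p43 : 0 <= 4 / 3 :> R by lra.
  apply: (ge0_ler_powR p43); rewrite ?nnegrE ?exprn_ge0 ?ler0n//.
  by rewrite -natrX ler_nat; apply: leq_trans (cbrt_le _) _; lia.
have hl : (ln 2 : R) `^ (2 / 3) <= (ln n%:R : R) `^ (2 / 3).
  have p23 : 0 <= 2 / 3 :> R by lra.
  apply: (ge0_ler_powR p23); rewrite ?nnegrE ?ln_ge0//; [lra|lra|].
  by rewrite ler_ln ?posrE//; lra.
set L := ln 2 `^ _ in l2 hl *; set M := ln n%:R `^ _ in hl *.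
set N := n%:R `^ _ in h *.
rewrite natrM natrX; move: (675%:R : R) C0 => C C0.
rewrite (_ : C / L * (N * M) = C * (N * (M / L))); last by ring.
rewrite ler_pM2l// (le_trans h)// ler_peMr ?powR_ge0//.
by rewrite ler_pdivlMr// mul1r.
Unshelve. all: by end_near. Qed.

(** * Counting punctures and assembling the family *)

Lemma card_image_seq (T : Type) (n : nat) (q : nat -> T) (A : set T)
    (s : seq nat) :
  (forall i j, (i < n)%N -> (j < n)%N -> q i = q j -> i = j) ->
  uniq s -> {subset s <= gtn n} ->
  (forall i, (i < n)%N -> A (q i) <-> i \in s) ->
  (q @` `I_n) `&` A #= `I_(size s).
Proof.
move=> qI us sn As; rewrite (_ : _ `&` _ = q @` [set` s]); last first.
  apply/seteqP; split=> [_ [[i /= ni <-] /As is_]|_ [i /= is_ <-]].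
    by exists i => //; exact: is_.
  have ni := sn _ is_; split; last by apply/As.
  by exists i.
apply: card_eq_trans (card_seq us).
apply: inj_card_eq => i j /set_mem /= /sn ni /set_mem /= /sn nj.
exact: qI.
Qed.

Theorem theorem1p3 (R : realType) :
  exists f : nat -> nat,
    (fun n : nat => (f n)%:R : R^o) =O_\oo
      (fun n : nat => n%:R `^ (4 / 3) * ln n%:R `^ (2 / 3) : R^o) /\
    forall (n : nat) (Q : set (sphere R)), Q #= `I_n ->
      exists Gamma : set (set (sphere R)),
        [/\ Gamma #<= `I_(f n),
            forall c, Gamma c -> simple_closed_curve Q c
          & realizes_all_types n Q Gamma].
Proof.
exists (fun n => (675 * side n ^ 4)%N); split; first exact: codes_size_bigO.
move=> n Q Qn.
have [inner [outer [crv [q [QE qI tame [ii io] pos]]]]] :=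
  exists_interval_disks Qn.
(* Punctures sit at positions congruent to 6 modulo 7, so each one is strictly on one side of the
   cuts and misses one of the two disks, whereas the curve lies in both. *)
have curveQ s t : (s < t)%N -> (s %% 7 != 6)%N -> (t %% 7 != 6)%N ->
    Q `&` crv s t = set0.
  move=> st s6 t6; apply/seteqP; split=> // p [Qp Cp].
  move: Qp; rewrite QE => -[i /= ni qi]; rewrite -qi in Cp.
  have [tin tou] := tame s t st.
  have [pin pou] := pos i s t ni st.
  have [h|h] : (s < 7 * i + 6 < t)%N \/
      ((7 * i + 6 < s)%N \/ (t < 7 * i + 6)%N) by lia.
    by have [_] := pin h; apply; exact: tame_circle_sub tou _ Cp.
  by have [_] := pou h; apply; exact: tame_circle_sub tin _ Cp.
(* The condition [st.1 < st.2] is imposed because [codes] also pairs cuts in the wrong order. *)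
exists [set C | exists2 st, st \in codes n &
  (st.1 < st.2)%N /\ C = crv st.1 st.2].
split.
- apply: (@card_le_trans _ _ _ ((fun st => crv st.1 st.2) @` [set` codes n])).
    by apply: subset_card_le => C [st stc [_ ->]]; exists st.
  apply: card_le_trans (card_image_le _ _) _.
  rewrite -size_codes.
  apply: (@card_le_trans _ _ _ (nth (0, 0)%N (codes n) @` `I_(size (codes n)))).
    apply: subset_card_le => st /= stc; exists (index st (codes n)).
      by rewrite /= index_mem.
    exact: nth_index.
  exact: card_image_le.
- move=> _ [[s t] /codes_neq6 /andP[s6 t6] [/= st ->]]; split.
    move=> p Cp Qp; suff : set0 p by [].
    by rewrite -(curveQ s t st s6 t6).
  by have [tin _] := tame s t st; exact: tame_circle_param tin.
move=> k1 k2 k3 k123 kn.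
have [u [u1 u2 u3 un]] := exists_cuts k123 kn.
set v := (u + k1)%N in u2 u3 un; set w := (v + k2)%N in u3 un.
have uv : (u <= v)%N by rewrite leq_addr.
have vw : (v <= w)%N by rewrite leq_addr.
have code1 : (7 * u + 1, 7 * v + 2)%N \in codes n.
  rewrite !mem_cat; apply/or3P/Or31.
  exact: (allpairs_f (fun u v => (7 * u + 1, 7 * v + 2)%N)).
have code2 : (7 * v + 3, 7 * w + 4)%N \in codes n.
  rewrite !mem_cat; apply/or3P/Or32.
  exact: (allpairs_f (fun v w => (7 * v + 3, 7 * w + 4)%N)).
have code3 : (7 * u, 7 * w + 5)%N \in codes n.
  rewrite !mem_cat; apply/or3P/Or33.
  exact: (allpairs_f (fun u w => (7 * u, 7 * w + 5)%N)).
have lt1 : (7 * u + 1 < 7 * v + 2)%N by lia.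
have lt2 : (7 * v + 3 < 7 * w + 4)%N by lia.
have lt3 : (7 * u < 7 * w + 5)%N by lia.
have [t1 _] := tame _ _ lt1; have [t2 _] := tame _ _ lt2.
(* The third disk is the outer one of the curve that encloses the other two. *)
have [_ t3] := tame _ _ lt3.
have d12 : inner (7 * u + 1)%N (7 * v + 2)%N `&`
           inner (7 * v + 3)%N (7 * w + 4)%N = set0 by apply: ii; lia.
have d13 : inner (7 * u + 1)%N (7 * v + 2)%N `&`
           outer (7 * u)%N (7 * w + 5)%N = set0 by apply: io; lia.
have d23 : inner (7 * v + 3)%N (7 * w + 4)%N `&`
           outer (7 * u)%N (7 * w + 5)%N = set0 by apply: io; lia.
have disj D C D' C' : tame_disk D C -> tame_disk D' C' -> D `&` D' = set0 ->
    [disjoint C & C'].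
  move=> tD tD' DD; rewrite disj_set2E; apply/eqP/seteqP; split=> // p [Cp C'p].
  by rewrite -DD; split; [exact: tame_circle_sub tD _ Cp
                         |exact: tame_circle_sub tD' _ C'p].
exists (crv (7 * u + 1)%N (7 * v + 2)%N), (crv (7 * v + 3)%N (7 * w + 4)%N),
  (crv (7 * u)%N (7 * w + 5)%N); split.
- split.
  + by exists (7 * u + 1, 7 * v + 2)%N.
  + by exists (7 * v + 3, 7 * w + 4)%N.
  + by exists (7 * u, 7 * w + 5)%N.
- by split; [exact: disj t1 t2 d12|exact: disj t1 t3 d13|exact: disj t2 t3 d23].
have in1 i : (i < n)%N ->
    inner (7 * u + 1)%N (7 * v + 2)%N (q i) <-> (i \in iota u k1).
  move=> ni; have [h1 h2] := pos i _ _ ni lt1; rewrite mem_iota -/v; split=> h.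
    apply/negPn/negP => iv; have [|_] := h2; first by lia.
    exact.
  by have [|] := h1; first by lia.
have in2 i : (i < n)%N ->
    inner (7 * v + 3)%N (7 * w + 4)%N (q i) <-> (i \in iota v k2).
  move=> ni; have [h1 h2] := pos i _ _ ni lt2; rewrite mem_iota -/w; split=> h.
    apply/negPn/negP => iv; have [|_] := h2; first by lia.
    exact.
  by have [|] := h1; first by lia.
have in3 i : (i < n)%N -> outer (7 * u)%N (7 * w + 5)%N (q i) <->
    (i \in iota 0 u ++ iota w (n - w)).
  move=> ni; have [h1 h2] := pos i _ _ ni lt3.
  rewrite mem_cat !mem_iota; split=> h.
    apply/negPn/negP => iv; have [|_] := h1; first by lia.
    exact.
  by have [|] := h2; first by lia.
apply: (pants_of_tame_disks t1 t2 t3 d12 d13 d23).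
- by exists n.
- rewrite QE => _ [i /= ni <-].
  have [iu|ui] := ltnP i u.
    by right; apply/in3; rewrite // mem_cat mem_iota iu.
  have [iv|vi] := ltnP i v.
    by left; left; apply/in1; rewrite // mem_iota ui.
  have [iw|wi] := ltnP i w.
    by left; right; apply/in2; rewrite // mem_iota vi.
  right; apply/in3; rewrite // mem_cat !mem_iota; lia.
- by apply: curveQ => //; lia.
- by apply: curveQ => //; lia.
- by apply: curveQ => //; lia.
- rewrite QE -(size_iota u k1); apply: (card_image_seq qI _ _ in1).
    exact: iota_uniq.
  by move=> i; rewrite mem_iota !inE -/v; lia.
- rewrite QE -(size_iota v k2); apply: (card_image_seq qI _ _ in2).
    exact: iota_uniq.
  by move=> i; rewrite mem_iota !inE -/w; lia.
(* The [u] punctures before the first cut and the [n - w] from the last cut on add up to [k3]. *)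
- have -> : k3 = size (iota 0 u ++ iota w (n - w)).
    by rewrite size_cat !size_iota /w /v in un *; lia.
  rewrite QE; apply: (card_image_seq qI _ _ in3).
    rewrite cat_uniq !iota_uniq /= andbT; apply/hasPn => i.
    by rewrite !mem_iota; lia.
  by move=> i; rewrite mem_cat !mem_iota !inE; lia.
Qed.
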